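(* Let $N\ge 2$ and let $T\in\overline{\mathrm{cv}}_N$ be a tree with free $F_N$-action. Let $P_T=\{\phi\in\mathrm{Stab}_{\mathrm{Out}(F_N)}([T]) : \lambda(\phi)=1\}$, where $\lambda$ is the stretching factor homomorphism. Then: (a) The group $P_T$ is finite, and the stabilizer $\mathrm{Stab}_{\mathrm{Out}(F_N)}([T])$ is virtually cyclic. Moreover, if $\mathrm{Stab}_{\mathrm{Out}(F_N)}([T])$ is finite then $\mathrm{Stab}_{\mathrm{Out}(F_N)}([T])=P_T$, and if $\mathrm{Stab}_{\mathrm{Out}(F_N)}([T])$ is infinite then $\mathrm{Stab}_{\mathrm{Out}(F_N)}([T])=P_T\rtimes\mathbb Z$ (a semidirect product with normal factor $P_T$ and an infinite cyclic group). (b) If $T$ does not have dense $F_N$-orbits of branch points, then $\mathrm{Stab}_{\mathrm{Out}(F_N)}([T])$ is finite.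
   Context: $F_N$ is the free group of rank $N$. An $\mathbb R$-tree is a path-connected non-empty metric space $T$ in which any two points $x,y$ are joined by a unique embedded arc $[x,y]$, and this arc is isometric to $[0,d(x,y)]\subseteq\mathbb R$. All actions of $F_N$ are left actions by isometries. The action is minimal if there is no non-empty $F_N$-invariant subtree of $T$ different from $T$. It is small if the stabilizer in $F_N$ of $[x,y]$ is cyclic for all $x\ne y$, and very small if in addition no non-trivial $w\in F_N$ inverts a non-degenerate segment or fixes a non-degenerate tripod. The valence of $x\in T$ is the number of connected components of $T\smallsetminus\{x\}$; a branch point is a point of valence at least $3$. $\overline{\mathrm{cv}}_N$ is the set of all $\mathbb R$-trees with a non-trivial (not a single point) minimal very small isometric action of $F_N$, up to $F_N$-equivariant isometry. $\overline{\mathrm{CV}}_N$ is its quotient by the relation $T_1\sim T_2$ if $T_1$ is $F_N$-equivariantly isometric to $cT_2$ (the tree $T_2$ with metric multiplied by $c$ and the same action) for some $c>0$; $[T]$ denotes the class of $T$. $\mathrm{Aut}(F_N)$ acts on the right on $\overline{\mathrm{cv}}_N$: $T\Phi$ is the metric space $T$ with the twisted action $w\cdot_{T\Phi}x:=\Phi(w)\cdot_T x$. Inner automorphisms act trivially, so this induces right actions of $\mathrm{Out}(F_N)$ on $\overline{\mathrm{cv}}_N$ and $\overline{\mathrm{CV}}_N$, with $[T]\phi=[T\phi]$. $\mathrm{Stab}_{\mathrm{Out}(F_N)}([T])=\{\phi\in\mathrm{Out}(F_N):[T]\phi=[T]\}$. For $\phi\in\mathrm{Stab}_{\mathrm{Out}(F_N)}([T])$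 the stretching factor $\lambda(\phi)>0$ is the unique number such that $T\phi$ is $F_N$-equivariantly isometric to $\lambda(\phi)T$. The map $\lambda:\mathrm{Stab}_{\mathrm{Out}(F_N)}([T])\to\mathbb R_{>0}$ is a homomorphism to the multiplicative group of positive reals. A group is virtually cyclic if it has a cyclic (possibly trivial) subgroup of finite index. *)

(* Defs.v *)
From HB Require Import structures.
From mathcomp Require Import all_boot all_order all_algebra.
From mathcomp Require Import mathcomp_extra boolp classical_sets functions.
From mathcomp Require Import cardinality reals interval_inference.
From mathcomp Require Import topology normedtype.

Set Implicit Arguments.
Unset Strict Implicit.
Unset Printing Implicit Defensive.

Import Order.TTheory GRing.Theory Num.Theory.
Import numFieldNormedType.Exports.

Local Open Scope classical_set_scope.
Local Open Scope quotient_scope.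
Local Open Scope group_scope.

(* The letter (i, false) stands for the i-th generator and (i, true) for its
   inverse; the elements of the free group are the reduced words. *)

Section Words.
Variable N : nat.
Implicit Types (a b : 'I_N * bool) (u v w s : seq ('I_N * bool)).

Definition linv a := (a.1, ~~ a.2).

Definition reduced w := sorted [rel a b | b != linv a] w.

Definition lcons a w :=
  if w is b :: w' then if b == linv a then w' else a :: w else [:: a].

Definition reduce w := foldr lcons [::] w.

Definition winv w := rev (map linv w).

Lemma linvK : involutive linv.
Proof. by case=> i b; rewrite /linv /= negbK. Qed.

Lemma reduced_lcons a w : reduced w -> reduced (lcons a w).
Proof.
case: w => [//|b w] /= rw; case: ifPn => [_|ba]; last by rewrite /= ba.
exact: path_sorted rw.
Qed.

Lemma reduced_foldr s w : reduced s -> reduced (foldr lcons s w).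
Proof. by move=> rs; elim: w => //= a w; exact: reduced_lcons. Qed.

Lemma reduced_reduce w : reduced (reduce w).
Proof. exact: reduced_foldr. Qed.

Lemma lconsK a w : reduced w -> lcons a (lcons (linv a) w) = w.
Proof.
case: w => [_|b w rw] /=; first by rewrite eqxx.
rewrite linvK; case: eqP => [ba|_] /=; last by rewrite eqxx.
case: w rw => [|c w] /=; first by rewrite ba.
by rewrite ba => /andP[/negPf ->].
Qed.

Lemma foldr_lcons s a w : reduced s ->
  foldr lcons s (lcons a w) = lcons a (foldr lcons s w).
Proof.
move=> rs; case: w => //= b w; case: eqP => // ->.
by rewrite lconsK //; exact: reduced_foldr.
Qed.

Lemma foldr_reduce s w : reduced s ->
  foldr lcons s (reduce w) = foldr lcons s w.
Proof. by move=> rs; elim: w => //= a w <-; exact: foldr_lcons. Qed.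

Lemma reduce_id w : reduced w -> reduce w = w.
Proof.
elim: w => //= a w IH rw; rewrite IH; last exact: path_sorted rw.
by case: w rw {IH} => //= b w /andP[/negPf ->].
Qed.

Lemma reduce_cat u v : reduce (u ++ v) = foldr lcons (reduce v) u.
Proof. by rewrite /reduce foldr_cat. Qed.

Lemma reduce_catl u v : reduce (reduce u ++ v) = reduce (u ++ v).
Proof. by rewrite !reduce_cat foldr_reduce // reduced_reduce. Qed.

Lemma reduce_catr u v : reduce (u ++ reduce v) = reduce (u ++ v).
Proof. by rewrite !reduce_cat (reduce_id (reduced_reduce v)). Qed.

Lemma winvK : involutive winv.
Proof.
by move=> w; rewrite /winv map_rev revK -map_comp map_id_in // => a _ /=;
  exact: linvK.
Qed.

Lemma reduced_winv w : reduced w -> reduced (winv w).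
Proof.
rewrite /reduced /winv rev_sorted sorted_map; apply: sub_sorted => a b /=.
by apply: contra => /eqP ->; rewrite linvK.
Qed.

Lemma reduce_winvl w : reduce (winv w ++ w) = [::].
Proof.
elim: w => //= a w IH; rewrite /winv map_cons rev_cons cat_rcons.
have := lconsK (linv a) (reduced_reduce w); rewrite linvK => aK.
by rewrite reduce_cat /= aK -reduce_cat.
Qed.

End Words.

Section FreeGroup.
Variable N : nat.

Record free_group := FreeGroup
  { fgword :> seq ('I_N * bool); fgword_reduced : reduced fgword }.

HB.instance Definition _ := [isSub for fgword].
HB.instance Definition _ := [Countable of free_group by <:].

Implicit Types x y z : free_group.

Definition fg_mul x y := FreeGroup (reduced_reduce (x ++ y)).
Definition fg_one : free_group := @FreeGroup [::] isT.
Definition fg_inv x := FreeGroup (reduced_winv (fgword_reduced x)).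

Fact fg_mulA : associative fg_mul.
Proof.
by move=> x y z; apply: val_inj; rewrite /= reduce_catl reduce_catr catA.
Qed.

Fact fg_mul1 : left_id fg_one fg_mul.
Proof. by move=> x; apply: val_inj; rewrite /= reduce_id // fgword_reduced. Qed.

Fact fg_mul1r : right_id fg_one fg_mul.
Proof.
by move=> x; apply: val_inj; rewrite /= cats0 reduce_id // fgword_reduced.
Qed.

Fact fg_mulV : left_inverse fg_one fg_inv fg_mul.
Proof. by move=> x; apply: val_inj; rewrite /= reduce_winvl. Qed.

Fact fg_mulVr : right_inverse fg_one fg_inv fg_mul.
Proof.
by move=> x; apply: val_inj; rewrite /= -{1}[fgword x]winvK reduce_winvl.
Qed.

HB.instance Definition _ :=
  isGroup.Build free_group fg_mulA fg_mul1 fg_mul1r fg_mulV fg_mulVr.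

End FreeGroup.

Section Automorphisms.
Variable G : groupType.

Record autg := AutG {
  autg_fun :> G -> G;
  autg_morph : {morph autg_fun : x y / x * y};
  autg_bij : bijective autg_fun }.

HB.instance Definition _ := gen_eqMixin autg.
HB.instance Definition _ := gen_choiceMixin autg.

Implicit Types f g h : autg.

Lemma autgP f g : f =1 g -> f = g.
Proof.
case: f g => [f fM fb] [g gM gb] /= /funext fg; subst g.
by rewrite (Prop_irrelevance fM gM) (Prop_irrelevance fb gb).
Qed.

Lemma autg1 f : f 1 = 1.
Proof. by apply: (mulgI (f 1)); rewrite -autg_morph !mulg1. Qed.

Lemma autgV f : {morph f : x / x^-1}.
Proof.
by move=> x; apply: (mulgI (f x)); rewrite -autg_morph !mulgV autg1.
Qed.

Definition autg_one : autg :=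
  @AutG idfun (fun _ _ => erefl) (Bijective (fun=> erefl) (fun=> erefl)).

Fact autg_mul_morph f g : {morph f \o g : x y / x * y}.
Proof. by move=> x y /=; rewrite !autg_morph. Qed.

(* The product is composition of functions, so that T (f * g) = (T f) g. *)
Definition autg_mul f g : autg :=
  AutG (@autg_mul_morph f g) (bij_comp (autg_bij f) (autg_bij g)).

Fact autg_inv_ex f : exists k : G -> G, cancel f k /\ cancel k f.
Proof. by case: (autg_bij f) => k fK kK; exists k. Qed.

Definition autg_inv_fun f : G -> G := sval (cid (autg_inv_ex f)).

Lemma autgK f : cancel f (autg_inv_fun f).
Proof. by case: (svalP (cid (autg_inv_ex f))). Qed.

Lemma autgVK f : cancel (autg_inv_fun f) f.
Proof. by case: (svalP (cid (autg_inv_ex f))). Qed.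

Fact autg_inv_morph f : {morph autg_inv_fun f : x y / x * y}.
Proof.
move=> x y; apply: (can_inj (autgK f)).
by rewrite autg_morph !autgVK.
Qed.

Definition autg_inv f : autg :=
  AutG (@autg_inv_morph f) (Bijective (autgVK f) (autgK f)).

Fact autg_mulA : associative autg_mul.
Proof. by move=> f g h; apply: autgP. Qed.
Fact autg_mul1 : left_id autg_one autg_mul.
Proof. by move=> f; apply: autgP. Qed.
Fact autg_mul1r : right_id autg_one autg_mul.
Proof. by move=> f; apply: autgP. Qed.
Fact autg_mulV : left_inverse autg_one autg_inv autg_mul.
Proof. by move=> f; apply: autgP => x /=; rewrite autgK. Qed.
Fact autg_mulVr : right_inverse autg_one autg_inv autg_mul.
Proof. by move=> f; apply: autgP => x /=; rewrite autgVK. Qed.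

HB.instance Definition _ :=
  isGroup.Build autg autg_mulA autg_mul1 autg_mul1r autg_mulV autg_mulVr.

Fact inng_morph (g : G) : {morph (fun x => g * x * g^-1) : x y / x * y}.
Proof. by move=> x y; rewrite !mulgA mulgVK. Qed.

Fact inng_bij (g : G) : bijective (fun x => g * x * g^-1).
Proof.
exists (fun x => g^-1 * x * g) => x.
- by rewrite !mulgA mulVg mul1g mulgVK.
- by rewrite !mulgA mulgV mul1g mulgK.
Qed.

Definition inng (g : G) : autg := AutG (@inng_morph g) (inng_bij g).

Definition outg_rel f h : bool := `[< exists g : G, f = inng g * h >].

Lemma outg_relP f h :
  outg_rel f h <-> exists g : G, forall x, f x = g * h x * g^-1.
Proof.
split=> [/asboolP[g ->]|[g fh]]; first by exists g.
by apply/asboolP; exists g; apply: autgP.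
Qed.

Fact outg_rel_equiv : equiv_class_of outg_rel.
Proof.
split.
- by move=> f; apply/outg_relP; exists 1 => x; rewrite mul1g invg1 mulg1.
- suff sym f h : outg_rel f h -> outg_rel h f.
    by move=> f h; apply/idP/idP; exact: sym.
  move=> /outg_relP[g fh]; apply/outg_relP; exists g^-1 => x.
  by rewrite fh invgK !mulgA mulVg mul1g mulgVK.
- move=> f h k /outg_relP[a fa] /outg_relP[b fb]; apply/outg_relP.
  by exists (a * b) => x; rewrite fa fb invgM !mulgA.
Qed.

Canonical outg_rel_canonical := EquivRelPack outg_rel_equiv.

Definition outg := {eq_quot outg_rel}.
HB.instance Definition _ := Choice.on outg.
HB.instance Definition _ := Quotient.on outg.
HB.instance Definition _ := EqQuotient.on outg.

Definition outg_one : outg := \pi_outg 1.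
Definition outg_mul (a b : outg) : outg := \pi_outg (repr a * repr b).
Definition outg_inv (a : outg) : outg := \pi_outg ((repr a)^-1).

Lemma eq_piP f h : \pi_outg f = \pi_outg h <->
  exists g : G, forall x, f x = g * h x * g^-1.
Proof.
rewrite -outg_relP; split=> [/eqmodP //|fh]; exact/eqmodP.
Qed.

Lemma pi_mul f h : outg_mul (\pi_outg f) (\pi_outg h) = \pi_outg (f * h).
Proof.
have /eq_piP[a fa] := reprK (\pi_outg f).
have /eq_piP[b hb] := reprK (\pi_outg h).
apply/eq_piP; exists (a * f b) => x /=.
by rewrite fa hb !autg_morph autgV invgM !mulgA.
Qed.

Lemma pi_inv f : outg_inv (\pi_outg f) = \pi_outg f^-1.
Proof.
have /eq_piP[a fa] := reprK (\pi_outg f).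
apply/eq_piP; exists (f^-1 a^-1) => x.
set h := repr _ in fa *.
apply: (can_inj (autgK h)).
rewrite [h (h^-1 x)]autgVK fa -[f^-1]/(autg_inv f).
by rewrite !autg_morph !autgV !autgVK invgK !mulgA mulgV mul1g mulgK.
Qed.

Fact outg_mulA : associative outg_mul.
Proof.
elim/quotW=> f; elim/quotW=> g; elim/quotW=> h.
by rewrite (pi_mul g h) (pi_mul f (g * h)) (pi_mul f g) (pi_mul (f * g) h) mulgA.
Qed.
Fact outg_mul1 : left_id outg_one outg_mul.
Proof. by elim/quotW=> f; rewrite (pi_mul 1 f) mul1g. Qed.
Fact outg_mul1r : right_id outg_one outg_mul.
Proof. by elim/quotW=> f; rewrite (pi_mul f 1) mulg1. Qed.
Fact outg_mulV : left_inverse outg_one outg_inv outg_mul.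
Proof. by elim/quotW=> f; rewrite (pi_inv f) (pi_mul f^-1 f) mulVg. Qed.
Fact outg_mulVr : right_inverse outg_one outg_inv outg_mul.
Proof. by elim/quotW=> f; rewrite (pi_inv f) (pi_mul f f^-1) mulgV. Qed.

HB.instance Definition _ :=
  isGroup.Build outg outg_mulA outg_mul1 outg_mul1r outg_mulV outg_mulVr.

End Automorphisms.

Section Subgroups.
Variable G : groupType.
Implicit Types (x y : G) (H K P Z : set G).

Definition expgz x (n : int) : G :=
  match n with Posz m => x ^+ m | Negz m => x ^- m.+1 end.

Definition is_subgroup H :=
  [/\ H 1, forall x y, H x -> H y -> H (x * y) & forall x, H x -> H x^-1].

Definition cyclic_subgroup H := exists x, H = range (expgz x).

Definition infinite_cyclic_subgroup H := cyclic_subgroup H /\ infinite_set H.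

Definition finite_index H K := finite_set [set [set x * h | h in H] | x in K].

Definition virtually_cyclic K :=
  is_subgroup K /\
  exists H, [/\ H `<=` K, cyclic_subgroup H & finite_index H K].

Definition normal_subgroup P K :=
  [/\ is_subgroup P, P `<=` K & forall x p, K x -> P p -> P (x * p * x^-1)].

Definition semidirect P Z K :=
  [/\ normal_subgroup P K, is_subgroup Z /\ Z `<=` K, P `&` Z = [set 1]
    & K = [set p * z | p in P & z in Z]].

End Subgroups.

Section RTrees.
Local Open Scope ring_scope.
Variables (R : realType) (T : metricType R).
Implicit Types (x y z : T) (A S : set T).

Definition path_connected := forall x y, exists gamma : R -> T,
  [/\ {within `[0, 1], continuous gamma}, gamma 0 = x & gamma 1 = y].

(* Injective continuous maps from [0, l] to T are embeddings, by compactness.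
   The case l = 0 gives the degenerate arc {x} from x to x. *)
Definition is_arc x y A := exists (l : R) (gamma : R -> T),
  [/\ 0 <= l,
      {within `[0, l], continuous gamma}
      /\ (forall s t, s \in `[0, l] -> t \in `[0, l] ->
            gamma s = gamma t -> s = t),
      gamma 0 = x,
      gamma l = y
    & A = gamma @` `[0, l]].

Definition isometric_to_interval A (l : R) := exists gamma : R -> T,
  (forall s t, s \in `[0, l] -> t \in `[0, l] ->
     mdist (gamma s) (gamma t) = `|s - t|)
  /\ A = gamma @` `[0, l].

Definition rtree :=
  [/\ [set: T] !=set0,
      path_connected
    & forall x y, exists A,
        [/\ is_arc x y A, forall B, is_arc x y B -> B = A
          & isometric_to_interval A (mdist x y)]].

(* The unique arc [x, y]; only meaningful when T is an R-tree. *)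
Definition segment x y : set T := xget set0 (is_arc x y).

(* A subset is a subtree when it is non-empty and arc-convex. *)
Definition subtree S :=
  S !=set0 /\ forall x y, S x -> S y -> segment x y `<=` S.

Definition tripod_center x a b c :=
  [/\ x <> a /\ segment x a `&` segment x b = [set x],
      x <> b /\ segment x b `&` segment x c = [set x]
    & x <> c /\ segment x c `&` segment x a = [set x]].

Definition tripod x a b c : set T := segment x a `|` segment x b `|` segment x c.

(* The valence of x is the cardinality of this set. *)
Definition directions x : set (set T) :=
  [set connected_component (~` [set x]) y | y in ~` [set x]].

Definition branch_point x := (`I_3 #<= directions x)%card.

End RTrees.

Section Actions.
Local Open Scope ring_scope.
Variables (R : realType) (G : groupType).

Record gspace := GSpace {
  gsort :> metricType R;
  act : G -> gsort -> gsort;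
  act1 : forall x, act 1%g x = x;
  actM : forall g h x, act (g * h)%g x = act g (act h x);
  act_isom : forall g x y, mdist (act g x) (act g y) = mdist x y }.

Implicit Types (T : gspace) (g : G) (Phi : autg G).

Definition act_free T := forall g (x : T), act g x = x -> g = 1%g.

Definition invariant_set T (S : set T) := forall g x, S x -> S (act g x).

Definition act_minimal T :=
  forall S : set T, subtree S -> invariant_set S -> S = [set: T].

Definition stab_set T (A : set T) : set G := [set g | act g @` A = A].

Definition act_small T := forall x y : T, x <> y ->
  cyclic_subgroup (stab_set (segment x y)).

Definition act_very_small T :=
  [/\ act_small T,
      forall g (x y : T), g <> 1%g -> x <> y -> ~ (act g x = y /\ act g y = x)
    & forall g (x a b c : T), g <> 1%g -> tripod_center x a b c ->
        ~ (forall z, tripod x a b c z -> act g z = z)].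

Definition act_orbit T (x : T) : set T := range (fun g => act g x).

Definition dense_branch_orbits T :=
  forall x : T, branch_point x -> dense (act_orbit x).

Definition equi_isometric (T1 T2 : gspace) := exists f : T1 -> T2,
  [/\ bijective f, forall x y, mdist (f x) (f y) = mdist x y
    & forall g x, f (act g x) = act g (f x)].

Fact twist1 T Phi (x : T) : act (Phi 1%g) x = x.
Proof. by rewrite autg1 act1. Qed.

Fact twistM T Phi g h (x : T) :
  act (Phi (g * h)%g) x = act (Phi g) (act (Phi h) x).
Proof. by rewrite autg_morph actM. Qed.

Definition twist T Phi : gspace :=
  @GSpace T (fun g => act (Phi g)) (twist1 Phi) (@twistM T Phi)
    (fun g => act_isom (Phi g)).

End Actions.

Definition rescaled (R : realType) (c : {posnum R}%R) (T : metricType R) : Type :=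
  T.

Section Rescaling.
Local Open Scope ring_scope.
Variables (R : realType) (c : {posnum R}) (T : metricType R).

HB.instance Definition _ := Choice.on (rescaled c T).

Definition rescaled_dist (x y : rescaled c T) : R :=
  c%:num * mdist (x : T) (y : T).

Fact rescaled_distxx x : rescaled_dist x x = 0.
Proof. by rewrite /rescaled_dist mdistxx mulr0. Qed.

Fact rescaled_dist_positivity x y : rescaled_dist x y = 0 -> x = y.
Proof.
move/eqP; rewrite mulf_eq0 (gt_eqF (gt0 c)) /= => /eqP.
exact: mdist_positivity.
Qed.

Fact rescaled_dist_sym x y : rescaled_dist x y = rescaled_dist y x.
Proof. by rewrite /rescaled_dist metric_sym. Qed.

Fact rescaled_dist_triangle y x z :
  rescaled_dist x z <= rescaled_dist x y + rescaled_dist y z.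
Proof. by rewrite -mulrDr ler_pM2l ?metric_triangle. Qed.

HB.instance Definition _ := @isMetric.Build R (rescaled c T)
  rescaled_dist rescaled_distxx rescaled_dist_positivity
  rescaled_dist_sym rescaled_dist_triangle.

End Rescaling.

Section Homothety.
Local Open Scope ring_scope.
Variables (R : realType) (G : groupType).
Implicit Types (T : gspace R G) (c : {posnum R}).

Fact gscale_isom c T g (x y : rescaled c T) :
  mdist (act g x : rescaled c T) (act g y) = mdist x y.
Proof. by rewrite /mdist /= /rescaled_dist act_isom. Qed.

Definition gscale c T : gspace R G :=
  @GSpace R G (rescaled c T) (@act R G T) (@act1 R G T) (@actM R G T)
    (@gscale_isom c T).

Definition homothetic (T1 T2 : gspace R G) :=
  exists c : {posnum R}, equi_isometric T1 (gscale c T2).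

End Homothety.

Section HomothetyTheory.
Local Open Scope ring_scope.
Variables (R : realType) (G : groupType).
Implicit Types (T : gspace R G) (c : {posnum R}).

Lemma homotheticP T1 T2 : homothetic T1 T2 <->
  exists (c : R) (f : T1 -> T2), 0 < c /\
    [/\ bijective f, forall x y, c * mdist (f x) (f y) = mdist x y
      & forall g x, f (act g x) = act g (f x)].
Proof.
split=> [[c [f [fb fd fe]]]|[c [f [c0 [fb fd fe]]]]].
- by exists c%:num, f; split.
- by exists (PosNum c0), f; split.
Qed.

Lemma homothetic_refl T : homothetic T T.
Proof.
apply/homotheticP; exists 1, idfun; split=> //; split=> //.
by move=> x y; rewrite mul1r.
Qed.

Lemma homothetic_sym T1 T2 : homothetic T1 T2 -> homothetic T2 T1.
Proof.
move=> /homotheticP[c [f [c0 [[h fK hK] fd fe]]]]; apply/homotheticP.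
exists c^-1, h; rewrite invr_gt0; split=> //; split.
- by exists f.
- by move=> x y; rewrite -fd !hK mulrA mulVf ?mul1r // gt_eqF.
- by move=> g x; apply: (can_inj fK); rewrite fe !hK.
Qed.

Lemma homothetic_trans T1 T2 T3 :
  homothetic T1 T2 -> homothetic T2 T3 -> homothetic T1 T3.
Proof.
move=> /homotheticP[c [f [c0 [fb fd fe]]]] /homotheticP[e [h [e0 [hb hd he]]]].
apply/homotheticP; exists (c * e), (h \o f); split; first exact: mulr_gt0.
split; first exact: bij_comp.
- by move=> x y; rewrite -mulrA /= hd fd.
- by move=> g x; rewrite /= fe he.
Qed.

Lemma autg_expgz (Phi : autg G) x n : Phi (expgz x n) = expgz (Phi x) n.
Proof.
have PhiX k : Phi (x ^+ k)%g = (Phi x ^+ k)%g.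
  by elim: k => [|k IH]; rewrite ?expg0 ?autg1 // !expgS autg_morph IH.
by case: n => k /=; rewrite ?autgV PhiX.
Qed.

Lemma twist_outg_rel T (Phi Psi : autg G) :
  \pi_(outg G) Phi = \pi_(outg G) Psi ->
  equi_isometric (twist T Phi) (twist T Psi).
Proof.
move=> /eq_piP[g PhiE]; exists (fun x : T => act g^-1%g x).
split.
- by exists (fun x : T => act g x) => x; rewrite -actM ?mulgV ?mulVg act1.
- by move=> x y; exact: (@act_isom R G T).
- by move=> h x /=; rewrite -!actM PhiE !mulgA mulVg mul1g.
Qed.

End HomothetyTheory.

Section CV.
Local Open Scope ring_scope.
Variables (R : realType) (N : nat).
Local Notation F := (free_group N).
Implicit Types (T : gspace R F) (phi : outg F).

Definition cvbar T :=
  [/\ rtree T, exists x y : T, x <> y, act_minimal T & act_very_small T].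

(* [T], as the class of all trees representing it.  Universe constraints
   prevent it from having type [set (gspace R F)]. *)
Definition CVclass T : gspace R F -> Prop :=
  fun T' => cvbar T' /\ homothetic T' T.

(* By out_twist_pi below, the choice of the representative is irrelevant up to
   equivariant isometry. *)
Definition out_twist T phi : gspace R F := twist T (repr phi).

Definition stabCV T : set (outg F) :=
  [set phi | CVclass (out_twist T phi) = CVclass T].

(* The unique c > 0 such that T phi is equivariantly isometric to c T; only
   meaningful when phi is in stabCV T. *)
Definition stretch T phi : {posnum R} :=
  xget 1%:pos [set c | equi_isometric (out_twist T phi) (gscale c T)].

Definition stretch_kernel T : set (outg F) :=
  [set phi | stabCV T phi /\ (stretch T phi)%:num = 1].

Lemma out_twist_pi T (Phi : autg F) :
  equi_isometric (out_twist T (\pi_(outg F) Phi)) (twist T Phi).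
Proof. by apply: twist_outg_rel; rewrite reprK. Qed.

Lemma cvbar_twist T (Phi : autg F) : cvbar T -> cvbar (twist T Phi).
Proof.
move=> [Ttree Tnt Tmin [Tsm Tinv Ttri]].
have PhiVK g : Phi (Phi^-1%g g) = g by exact: autgVK.
have PhiK g : Phi^-1%g (Phi g) = g by exact: autgK.
have Phi_neq1 g : g <> 1%g -> Phi g <> 1%g.
  by move=> g1 Pg; apply: g1; rewrite -[g]PhiK Pg autg1.
split=> //.
- move=> S Ssub Sinv; apply: Tmin => // g x Sx.
  by rewrite -[g]PhiVK; exact: (Sinv (Phi^-1%g g) x Sx).
- split.
  + move=> x y xy; have [w wE] := Tsm x y xy; exists (Phi^-1%g w).
    apply/seteqP; split=> [g gst|_ [n _ <-]].
      have : stab_set (segment (x : T) y) (Phi g) by [].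
      by rewrite wE => -[n _ nE]; exists n; rewrite // -autg_expgz nE PhiK.
    have : stab_set (segment (x : T) y) (expgz w n) by rewrite wE; exists n.
    by rewrite -{1}[w]PhiVK -autg_expgz.
  + by move=> g x y /Phi_neq1; exact: Tinv.
  + by move=> g x a b c /Phi_neq1; exact: Ttri.
Qed.

Lemma CVclass_eqP T1 T2 : cvbar T1 ->
  CVclass T1 = CVclass T2 <-> homothetic T1 T2.
Proof.
move=> cT1; split=> [T12|T12].
  have : CVclass T1 T1 by split=> //; exact: homothetic_refl.
  by rewrite T12 => -[].
apply/funext => T; apply/propext.
split=> -[cT TT]; split=> //; first exact: homothetic_trans T12.
exact: homothetic_trans (homothetic_sym T12).
Qed.

Lemma stabCV_P T phi : cvbar T ->
  stabCV T phi <->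
  exists c : {posnum R}, equi_isometric (out_twist T phi) (gscale c T).
Proof. by move=> cT; apply: CVclass_eqP; exact: cvbar_twist. Qed.

End CV.

(* Main.v *)
Require Import Defs.
From mathcomp Require Import all_boot all_order all_algebra.
From mathcomp Require Import mathcomp_extra boolp classical_sets functions.
From mathcomp Require Import cardinality reals interval_inference.
From mathcomp Require Import topology normedtype.
From mathcomp Require Import zify ring lra.

(** A class in the stabilizer is realized by a homothety [H] of the tree [T] that
    normalizes the action: [H (g x) = Phi g (H x)] and [H] multiplies distances by
    the stretching factor.  The proof studies these homotheties through their action
    on the branch points of [T] and on the directions at them.

    Finiteness.  The index inequality of Gaboriau and Levitt ([index_bound]) bounds
    the number of orbits of branch points and of directions at them.  It is proved
    here by a count: the Euler characteristic of a large finite subtree [K] of [T] is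
    compared with those of the subtrees along which the generators map [K] to itself,
    and the contributions are sorted by orbits; freeness makes the part of an orbit
    that lies in [K] a subforest of the Cayley tree.  Hence homotheties have finitely
    many types, according to the permutation of the orbits of directions
    ([finite_types]), and two homotheties of the same type differ by a pure one,
    which fixes all orbits of directions.

    Rigidity.  A pure homothety can be composed with a group element so as to fix a
    given branch point; by freeness it then fixes each direction at every branch
    point that it fixes.  If it is an isometry, it is the identity: a moved point
    would branch off from the fixed set at a branch point, in a direction which is
    not fixed ([pure_isometry_id]).  So the kernel of the stretching factor injects
    into the finite set of types.

    Discreteness.  Pure homotheties which fix the same branch point commute, their
    commutator being a pure isometry.  So all of them expand a common segment [x,z]
    along itself ([pure_overlap]).  Let [p] be a branch point inside this segment,
    and let [u] be the group element that moves [p] as [H] does.  Comparing [H] with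
    [u], one finds that [u] shifts a segment at [p] along [x,z] by an amount
    proportional to [c - 1], where [c] is the factor of [H] ([overlap_shift]).
    Elements with small shifts commute, because the action is free.  As centralizers
    in free groups are cyclic up to finite index ([centralizer_finite]), the shifts
    cannot be arbitrarily small, and so [c] stays away from 1 ([pure_gap]).  By
    finiteness of types the stretching factors form a discrete, hence cyclic, group
    ([stretch_generator]), which gives the semidirect product.

    Density.  If some stretching factor differs from 1, then some pure homothety
    fixes a given branch point [x] and contracts [T], while it preserves the orbit of
    [x].  Every point is at bounded distance from this orbit, so the orbit is dense
    ([pure_dense]). *)

Set Implicit Arguments.
Unset Strict Implicit.
Unset Printing Implicit Defensive.

Import Order.TTheory GRing.Theory Num.Theory.
Import numFieldNormedType.Exports.

Local Open Scope classical_set_scope.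

Local Open Scope group_scope.

(** * Words in free groups *)

Section IntegerPowers.
Variable G : groupType.
Implicit Types x y : G.

Lemma expgzS x n : expgz x (n + 1)%R = x * expgz x n.
Proof.
case: n => [n|[|n]].
- by rewrite -PoszD addn1 /= expgS.
- by rewrite /= expg1 mulgV.
- have -> : (Negz n.+1 + 1)%R = Negz n by lia.
  by rewrite /= (expgSr x n.+1) invgM mulgA mulgV mul1g.
Qed.

Lemma expgzD x m n : expgz x (m + n)%R = expgz x m * expgz x n.
Proof.
elim/int_rec: m => [|m IH|m IH]; first by rewrite add0r mul1g.
  by rewrite -addn1 PoszD -addrA (addrC 1%R) addrA !expgzS IH mulgA.
apply: (mulgI x); rewrite mulgA -!expgzS.
have -> : (- m.+1%:Z + n + 1 = - m%:Z + n)%R by lia.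
by have -> : (- m.+1%:Z + 1 = - m%:Z)%R by lia.
Qed.

Lemma expgzN x n : expgz x (- n)%R = (expgz x n)^-1.
Proof. by apply: (mulgI (expgz x n)); rewrite -expgzD subrr mulgV. Qed.

Lemma expgz1 x : expgz x 1 = x.
Proof. by rewrite /= expg1. Qed.

Lemma commute_expgz x y n : commute x y -> commute x (expgz y n).
Proof. by case: n => n xy /=; [|apply: commuteV]; apply: commuteX. Qed.

Lemma expgz_subgroup x : is_subgroup (range (expgz x)).
Proof.
split; first by exists 0%R.
- by move=> _ _ [m _ <-] [n _ <-]; exists (m + n)%R; rewrite ?expgzD.
- by move=> _ [m _ <-]; exists (- m)%R; rewrite ?expgzN.
Qed.

End IntegerPowers.

Section Words.
Variable N : nat.
Local Notation F := (free_group N).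
Implicit Types (a b : 'I_N * bool) (g h u v w : F) (s t : seq ('I_N * bool)).

Definition letter a : F := @FreeGroup N [:: a] isT.

Definition starts a g : bool := ohead g == Some a.

Definition wlen g : nat := size g.
Arguments wlen _%_g.

Lemma fgmulE g h : fgword (g * h) = reduce (fgword g ++ fgword h).
Proof. by []. Qed.

Lemma letter_mulE a g : fgword (letter a * g) = lcons a g.
Proof. by rewrite fgmulE /= -/(reduce g) reduce_id // fgword_reduced. Qed.

Lemma letterV a : (letter a)^-1 = letter (linv a).
Proof. exact: val_inj. Qed.

Lemma starts_letter_mul a g : starts a (letter a * g) = ~~ starts (linv a) g.
Proof.
rewrite /starts letter_mulE; case: g => [[|b s] /= rs]; first by rewrite eqxx.
have [ba|ba] := eqVneq b (linv a).
  rewrite ba in rs *; rewrite ?eqxx /=; case: s rs => [|c s] //= /andP[].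
  rewrite linvK => ca _; apply/negbTE.
  by apply: contra_neq ca => -[].
by rewrite /= eqxx; apply/esym; apply: contra_neq ba => -[].
Qed.

Lemma starts_exists g : g <> 1 -> exists a, starts a g.
Proof.
case: g => [[|a s] rs] g1; last by exists a; rewrite /starts /=.
by case: g1; exact: val_inj.
Qed.

Lemma free_group_ind (P : F -> Prop) :
  P 1 -> (forall a g, P g -> P (letter a * g)) -> forall g, P g.
Proof.
move=> P1 PM; suff H s (rs : reduced s) : P (FreeGroup rs).
  by case.
elim: s rs => [|a s IH] rs.
  by have -> : FreeGroup rs = 1 by exact: val_inj.
have rs' : reduced s by apply: path_sorted rs.
have -> : FreeGroup rs = letter a * FreeGroup rs'; last exact: PM.
apply: val_inj; rewrite /= -/(reduce s) (reduce_id rs').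
by case: (s) rs => //= b s' /andP[/negPf ->].
Qed.

Lemma letter_neq1 a : letter a <> 1.
Proof. by move/(congr1 (@fgword N)). Qed.

Lemma letters_not_commute (i j : 'I_N) : i != j ->
  letter (i, false) * letter (j, false) <>
  letter (j, false) * letter (i, false).
Proof.
move=> ij /(congr1 (@fgword N)); rewrite !letter_mulE /= /linv /= !xpair_eqE.
by rewrite !andbF => -[/eqP]; rewrite (negPf ij).
Qed.

Fixpoint common_prefix s t : nat :=
  match s, t with
  | a :: s', b :: t' => if a == b then (common_prefix s' t').+1 else 0
  | _, _ => 0
  end.

Lemma common_prefix_min s t r :
  (minn (common_prefix s t) (common_prefix t r) <= common_prefix s r)%N.
Proof.
elim: s t r => [|a s IH] [|b t] [|c r] //=; rewrite ?min0n ?minn0 //.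
have [->|] := eqVneq a b; last by rewrite min0n.
by have [_|_] := eqVneq b c; rewrite ?minnSS ?ltnS ?IH ?minn0.
Qed.

Lemma common_prefix_take s t k :
  (k <= common_prefix s t)%N -> take k s = take k t.
Proof.
elim: s t k => [|a s IH] [|b t] [|k] //=.
by have [->|] := eqVneq a b => //= /IH ->.
Qed.

Lemma size_reduce_winv s t : reduced s -> reduced t ->
  (size (reduce (winv s ++ t)) + (common_prefix s t).*2 = size s + size t)%N.
Proof.
elim: s t => [t _ rt|a s IH t rs rt]; first by rewrite /= addn0 reduce_id.
have winv_cons : winv (a :: s) = rcons (winv s) (linv a).
  by rewrite /winv map_cons rev_cons.
have rs' : reduced s by apply: path_sorted rs.
case: t rt => [|b t] rt.
  by rewrite cats0 reduce_id ?reduced_winv //= size_rev size_map addn0.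
rewrite /=; have [ab|ab] := eqVneq a b.
  rewrite winv_cons cat_rcons -reduce_catr.
  have -> : reduce (linv a :: b :: t) = t.
    rewrite -ab in rt *; have rt' : reduced t by apply: path_sorted rt.
    by rewrite /= -/(reduce t) (reduce_id rt') -{2}(linvK a) lconsK.
  have := IH t rs' (path_sorted rt); lia.
rewrite reduce_id ?size_cat ?size_rev ?size_map ?addn0 //.
have rw := reduced_winv rs; move: rw; rewrite winv_cons cat_rcons.
have ba : b != linv (linv a) by rewrite linvK eq_sym.
case: (winv s) => [|c r] /=; first by rewrite /reduced /= ba.
rewrite /reduced /= rcons_path cat_path /= => /andP[-> ->] /=.
by rewrite ba.
Qed.

(** The distance of [g] and [h] in the Cayley tree is [wlen (g^-1 * h)], so that
    [common_prefix] is their Gromov product at the identity, and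
    [common_prefix_min] is the four-point condition. *)
Lemma wlen_mulV g h :
  (wlen (g^-1 * h) + (common_prefix g h).*2 = wlen g + wlen h)%N.
Proof.
by rewrite /wlen fgmulE size_reduce_winv // fgword_reduced.
Qed.

Lemma wlenV g : wlen g^-1 = wlen g.
Proof. by rewrite /wlen /= size_rev size_map. Qed.

(** If the first half of [u] were also the first half of [u^-1], then [u] would be
    of the form [q^-1 q]. *)
Lemma common_prefix_half u k :
  u <> 1 -> (k <= common_prefix u (u^-1 : F))%N -> wlen u <> k.*2.
Proof.
move=> u1 /common_prefix_take uk ul; apply: u1; apply: val_inj => /=.
have ukE : take k u = winv (drop k u).
  rewrite uk /= /winv take_rev size_map map_drop; congr (rev (drop _ _)).
  by move: ul; rewrite /wlen; lia.
rewrite -[fgword u]reduce_id ?fgword_reduced // -(cat_take_drop k u) ukE.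
exact: reduce_winvl.
Qed.

(** If [v] commutes with [u] and is at least as long, then multiplication by [u]
    or by its inverse shortens [v].  Otherwise [v] would share half of [u] and half
    of [u^-1] as prefixes, forcing [u] to be of the form [q^-1 q]. *)
Lemma commuting_shorten u v : u <> 1 -> commute u v -> (wlen u <= wlen v)%N ->
  (wlen (u * v) < wlen v)%N \/ (wlen (u^-1 * v) < wlen v)%N.
Proof.
move=> u1 uv luv.
have [|h1] := ltnP (wlen (u * v)) (wlen v); first by left.
have [|h2] := ltnP (wlen (u^-1 * v)) (wlen v); first by right.
have e1 : (wlen (u * v) + (common_prefix (u^-1 : F) v).*2 = wlen u + wlen v)%N.
  by have := wlen_mulV u^-1 v; rewrite invgK wlenV.
have e2 := wlen_mulV u v.
have e3 := wlen_mulV u (u * v); rewrite mulKg in e3.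
have e4 := wlen_mulV v (u * v); rewrite {1}[u * v]uv mulKg in e4.
have h3 := common_prefix_min u (u * v : F) v.
have h4 := common_prefix_min u v (u^-1 : F).
have sym s t : common_prefix s t = common_prefix t s.
  by elim: s t => [|a s IH] [|b t] //=; rewrite eq_sym IH.
rewrite (sym (u * v : F) v) in h3; rewrite (sym v (u^-1 : F)) in h4.
have h5 := @common_prefix_half u (common_prefix u v) u1.
exfalso; apply: h5; clear sym; lia.
Qed.

(** The centralizer of a non-trivial element [u] of a free group is finite modulo
    the powers of [u]. *)
Lemma centralizer_finite u v : u <> 1 -> commute u v ->
  exists k r, (wlen r <= wlen u)%N /\ v = expgz u k * r.
Proof.
move=> u1; have [n] := ubnP (wlen v); elim: n v => // n IH v lvn uv.
have [lvu|luv] := leqP (wlen v) (wlen u).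
  by exists 0%R, v; rewrite mul1g.
have [h|h] := commuting_shorten u1 uv (ltnW luv).
  have [||k [r [lr e]]] := IH (u * v); [lia|exact: commuteM|].
  exists (k - 1)%R, r; split => //.
  by rewrite addrC expgzD -mulgA -e expgzN expgz1 mulKg.
have [||k [r [lr e]]] := IH (u^-1 * v); [lia| |].
  by apply: commuteM => //; apply: commuteV.
exists (k + 1)%R, r; split => //.
by rewrite expgzS -mulgA -e mulVKg.
Qed.

End Words.

Local Close Scope group_scope.
Local Open Scope ring_scope.

(** * Gromov products *)

Section GromovProduct.
Variables (R : realType) (T : metricType R).
Implicit Types p q x y z a b c : T.

(** Twice the Gromov product of [a] and [b] at [p].  In a tree this is twice the
    length of the common part of the segments [p,a] and [p,b]; in particular it
    vanishes exactly when [p] lies on the segment [a,b]. *)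
Definition gp p a b : R := mdist p a + mdist p b - mdist a b.

(** In a tree, this says that [a] and [b] lie in the same component of the
    complement of [p], in other words in the same direction at [p]. *)
Definition same_dir p a b : bool := 0 < gp p a b.

(** The metric shadow of the topological notion of a tree: the four-point
    condition and the existence of points at prescribed distances on a segment. *)
Definition tree_metric :=
  (forall p a b c, gp p a b <= gp p a c \/ gp p b c <= gp p a c) /\
  (forall x y (t : R), 0 <= t <= mdist x y ->
     exists z, mdist x z = t /\ mdist z y = mdist x y - t).

(** A branch point, witnessed by three points in pairwise different directions. *)
Definition forked x := exists a b c,
  [/\ x <> a, x <> b & x <> c] /\ [/\ gp x a b = 0, gp x b c = 0 & gp x a c = 0].

End GromovProduct.

(** * Distances *)

(** Restated over a [realType], so that all distances have the same syntactic
    form. *)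
Section RealMetric.
Variables (R : realType) (T : metricType R).

Lemma dist_sym (x y : T) : mdist x y = mdist y x.
Proof. exact: metric_sym. Qed.

Lemma dist_tri (x y z : T) : mdist x z <= mdist x y + mdist y z.
Proof. exact: metric_triangle. Qed.

Lemma dist_ge0 (x y : T) : 0 <= mdist x y.
Proof. exact: mdist_ge0. Qed.

Lemma distxx (x : T) : mdist x x = 0.
Proof. exact: mdistxx. Qed.

End RealMetric.

(** Decides linear consequences, in the goal, of facts about distances: distances
    are made symmetric and non-negative, then become variables. *)
Ltac mdist_lra := rewrite /gp ?distxx; unfold reverse_coercion;
  repeat match goal with |- context [@mdist ?K ?M ?a ?b] =>
    let E := fresh in
    have E : @mdist K M b a = @mdist K M a b by [exact: dist_sym];
    rewrite ?E; clear E;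
    have E : 0 <= @mdist K M a b by [exact: dist_ge0];
    move: E; generalize (@mdist K M a b) end; clear; intros; lra.

(** * From unique arcs to the four-point condition *)

Section Geodesics.
Variables (R : realType) (T : metricType R).
Hypothesis hT : rtree T.
Implicit Types p q x y z a b c : T.

Let itvE (l s : R) : `[0, l]%classic s = (0 <= s <= l) :> Prop.
Proof. by rewrite /= in_itv. Qed.

Lemma lipschitz_within (l : R) (f : R -> T) :
  (forall s t, 0 <= s <= l -> 0 <= t <= l -> mdist (f s) (f t) <= `|s - t|) ->
  {within `[0, l], continuous f}.
Proof.
move=> fL; apply/subspace_continuousP => s /=; rewrite in_itv /= => sl.
apply/metricType_numDomainType.cvgrPdist_lt => e e0.
rewrite near_withinE; near=> t.
rewrite /= in_itv /= => tl; apply: le_lt_trans (fL _ _ sl tl) _.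
near: t; exact: (@cvgr_dist_lt _ R^o _ _ _ id).
Unshelve. all: by end_near. Qed.

Lemma geodesic_path x y : exists f : R -> T,
  [/\ f 0 = x, f (mdist x y) = y & forall s t, 0 <= s <= mdist x y ->
     0 <= t <= mdist x y -> mdist (f s) (f t) = `|s - t|].
Proof.
have [_ _ /(_ x y)[A [[l [g [l0 _ g0 gl AE]]] _ [f [fi Af]]]]] := hT.
have Ax : A x by rewrite AE; exists 0; rewrite // itvE lexx.
have Ay : A y by rewrite AE; exists l; rewrite // itvE lexx l0.
move: Ax Ay; rewrite Af => -[s + fs] [t + ft]; rewrite !itvE => sl tl.
have d0 := mdist_ge0 x y.
have := fi s t; rewrite !in_itv /= fs ft => /(_ sl tl) dst.
have fi' u v : 0 <= u <= mdist x y -> 0 <= v <= mdist x y ->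
    mdist (f u) (f v) = `|u - v| by move=> ? ?; apply: fi; rewrite in_itv.
(* The isometric parametrization may run from [y] to [x]. *)
have [st|ts] := leP s t.
- have s0 : s = 0 by move: dst; rewrite ler0_norm ?subr_le0 //; lra.
  have tE : t = mdist x y by move: dst; rewrite ler0_norm ?subr_le0 //; lra.
  by exists f; split; rewrite -?s0 -?tE // s0 tE.
- have t0 : t = 0 by move: dst; rewrite gtr0_norm ?subr_gt0 //; lra.
  have sE : s = mdist x y by move: dst; rewrite gtr0_norm ?subr_gt0 //; lra.
  exists (fun u => f (mdist x y - u)); split.
  + by rewrite subr0 -sE.
  + by rewrite subrr -t0.
  + move=> u v hu hv; rewrite fi'; [|lra|lra].
    by rewrite distrC; congr `|_|; lra.
Qed.

(** The key consequence of the uniqueness of arcs: gluing two geodesics that meet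
    only at their common end point gives an arc, which must be isometric to an
    interval. *)
Lemma glued_geodesic x p y (f g : R -> T) :
  f 0 = x -> f (mdist x p) = p -> g 0 = p -> g (mdist p y) = y ->
  (forall s t, 0 <= s <= mdist x p -> 0 <= t <= mdist x p ->
     mdist (f s) (f t) = `|s - t|) ->
  (forall s t, 0 <= s <= mdist p y -> 0 <= t <= mdist p y ->
     mdist (g s) (g t) = `|s - t|) ->
  (forall s t, 0 <= s < mdist x p -> 0 <= t <= mdist p y -> f s <> g t) ->
  exists A, [/\ is_arc x y A, A p & mdist x y = mdist x p + mdist p y].
Proof.
move=> f0 fl g0 gl fi gi fg.
have d1 := mdist_ge0 x p; have d2 := mdist_ge0 p y.
set a := mdist x p in f0 fl fi fg d1 *; set b := mdist p y in g0 gl gi fg d2 *.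
pose h s := if s <= a then f s else g (s - a).
have hi s t : 0 <= s <= a + b -> 0 <= t <= a + b -> s <= t ->
    mdist (h s) (h t) <= t - s.
  move=> hs ht st; rewrite /h; case: (leP t a) => ta.
    have -> : s <= a by lra.
    by rewrite fi; [rewrite ler0_norm; lra|lra|lra].
  case: (leP s a) => sa.
    apply: le_trans (metric_triangle _ p _) _; rewrite -{1}fl -g0.
    by rewrite fi ?gi; [rewrite ?ler0_norm; lra|lra|lra|lra|lra].
  by rewrite gi; [rewrite ler0_norm; lra|lra|lra].
pose A := h @` `[0, a + b].
have hA : is_arc x y A.
  exists (a + b), h; split => //; first lra.
  - split.
      apply: lipschitz_within => s t hs ht; case: (leP s t) => st.
        by rewrite ler0_norm ?subr_le0 // opprB; exact: hi.
      by rewrite metric_sym ?gtr0_norm ?subr_gt0 //; apply: hi => //; lra.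
    have inj (k : R -> T) l : (forall s t, 0 <= s <= l -> 0 <= t <= l ->
        mdist (k s) (k t) = `|s - t|) ->
        forall s t, 0 <= s <= l -> 0 <= t <= l -> k s = k t -> s = t.
      move=> ki s t hs ht e; have := ki s t hs ht; rewrite e mdistxx.
      by move/esym/eqP; rewrite normr_eq0 subr_eq0 => /eqP.
    move=> s t; rewrite !in_itv /= /h => hs ht.
    case: (leP s a) => sa; case: (leP t a) => ta.
    + by apply: (inj _ _ fi); lra.
    + have [sa'|sa'|sa'] := ltgtP s a; [|lra|].
        by move=> e; case: (fg s (t - a)) => //; lra.
      by rewrite sa' fl -g0 => /(inj _ _ gi); lra.
    + have [ta'|ta'|ta'] := ltgtP t a; [|lra|].
        by move=> /esym e; case: (fg t (s - a)) => //; lra.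
      by rewrite ta' fl -g0 => /(inj _ _ gi); lra.
    + by move=> /(inj _ _ gi); lra.
  - by rewrite /h d1.
  - rewrite /h; case: leP => [ab|_]; last by rewrite addrAC subrr add0r.
    have b0 : b = 0 by lra.
    by rewrite b0 addr0 fl -gl b0 g0.
have Ap : A p.
  by exists a; [rewrite itvE; lra | rewrite /h lexx].
exists A; split => //.
have [_ _ /(_ x y)[B [_ uB [k [ki Bk]]]]] := hT.
have {}Bk : A = k @` `[0, mdist x y] by rewrite (uB A hA).
have Ax : A x by exists 0; [rewrite itvE; lra | rewrite /h d1].
have Ay : A y.
  by case: (hA) => l [g' [l0 _ _ gl' ->]]; exists l; rewrite // itvE lexx l0.
move: Ax Ay Ap; rewrite Bk => -[s + ks] [t + kt] [u + ku].
rewrite !itvE => hs ht hu.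
have := ki s t; have := ki s u; have := ki u t.
rewrite !in_itv /= ks kt ku => /(_ hu ht) e1 /(_ hs hu) e2 /(_ hs ht) e3.
have := metric_triangle x p y; rewrite -/a -/b.
move: e1 e2 e3; rewrite -/a -/b.
case: (ger0P (u - t)) => h1; case: (ger0P (s - u)) => h2;
  case: (ger0P (s - t)) => h3; lra.
Qed.

End Geodesics.

Section TreeGeometry.
Variables (R : realType) (T : metricType R).
Hypothesis hT : rtree T.
Implicit Types p q x y z a b c : T.

Let itvE (l s : R) : `[0, l]%classic s = (0 <= s <= l) :> Prop.
Proof. by rewrite /= in_itv. Qed.

Let geodesic x y (f : R -> T) := [/\ f 0 = x, f (mdist x y) = y
  & forall s t, 0 <= s <= mdist x y -> 0 <= t <= mdist x y ->
     mdist (f s) (f t) = `|s - t|].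

Let geodesic_from x y f s : geodesic x y f -> 0 <= s <= mdist x y ->
  mdist x (f s) = s /\ mdist (f s) y = mdist x y - s.
Proof.
move=> [f0 f1 fi] hs; have d0 := mdist_ge0 x y; split.
  by rewrite -{1}f0 fi ?sub0r ?normrN ?ger0_norm; lra.
by rewrite -{1}f1 fi ?ler0_norm; lra.
Qed.

(** Geodesics from [x] to [m] and from [m] to [y] meet only at [m], by the triangle
    inequality. *)
Lemma between_arc x y m : gp m x y = 0 -> exists2 A, is_arc x y A & A m.
Proof.
rewrite /gp => mxy; have [f gf] := geodesic_path hT x m.
have [g gg] := geodesic_path hT m y.
have [f0 f1 fi] := gf; have [g0 g1 gi] := gg.
have [|A [? ? _]] := glued_geodesic hT f0 f1 g0 g1 fi gi; last by exists A.
move=> s t hs ht fg.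
have [|e1 e2] := geodesic_from gf (s := s); [lra|].
have [|e3 e4] := geodesic_from gg (s := t); [lra|].
have := metric_triangle x (f s) y; rewrite e1 fg e4.
move: mxy; rewrite (metric_sym m x); lra.
Qed.

Lemma geodesic_arc x y f : geodesic x y f ->
  is_arc x y (f @` `[0, mdist x y]).
Proof.
move=> [f0 f1 fi]; exists (mdist x y), f; split => //; first exact: mdist_ge0.
split.
  by apply: lipschitz_within => s t hs ht; rewrite fi.
move=> s t; rewrite !in_itv /= => hs ht e; have := fi s t hs ht.
by rewrite e mdistxx => /esym/eqP; rewrite normr_eq0 subr_eq0 => /eqP.
Qed.

Let arc_unique x y A B : is_arc x y A -> is_arc x y B -> A = B.
Proof.
have [_ _ /(_ x y)[C [_ uC _]]] := hT.
by move=> /uC -> /uC ->.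
Qed.

Lemma between_geodesic x y m f : geodesic x y f -> gp m x y = 0 ->
  exists2 s, 0 <= s <= mdist x y & f s = m.
Proof.
move=> gf /between_arc[A hA Am].
move: Am; rewrite (arc_unique hA (geodesic_arc gf)) => -[s + <-].
by rewrite itvE; exists s.
Qed.

Lemma between_order x y m n : gp m x y = 0 -> gp n x y = 0 ->
  mdist x m <= mdist x n -> gp m x n = 0.
Proof.
have [f gf] := geodesic_path hT x y.
move=> /(between_geodesic gf)[s hs <-] /(between_geodesic gf)[t ht <-].
have [e1 _] := geodesic_from gf hs; have [e2 _] := geodesic_from gf ht.
have [_ _ fi] := gf; rewrite e1 e2 => st.
rewrite /gp metric_sym e1 e2 fi // ler0_norm; lra.
Qed.

(** The median of [x], [y], [z] is the first point of the segment [x,z] met when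
    travelling from [y] towards [x]. *)
Lemma median x y z :
  exists p, [/\ gp p x y = 0, gp p y z = 0 & gp p x z = 0].
Proof.
have [f gf] := geodesic_path hT y x; have [f0 f1 fi] := gf.
pose e w := gp w x z.
have e_ge0 w : 0 <= e w.
  by have := metric_triangle x w z; rewrite /e /gp (metric_sym w x); lra.
have eL v w : e v <= e w + mdist v w *+ 2.
  have := metric_triangle v w x; have := metric_triangle v w z.
  by rewrite /e /gp mulr2n; lra.
pose S : set R := [set s | 0 <= s <= mdist y x /\ e (f s) = 0].
have d0 := mdist_ge0 y x.
have Sd : S (mdist y x).
  by split; [lra | rewrite f1 /e /gp mdistxx add0r subrr].
have S0 : has_inf S.
  by split; [exists (mdist y x) | exists 0 => s [] /andP[]].
pose s0 := inf S.
have s0S s : S s -> s0 <= s by move=> Ss; apply: ge_inf => //; case: S0.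
have s00 : 0 <= s0 by apply: lb_le_inf; [case: S0 | move=> s [] /andP[]].
have hs0 : 0 <= s0 <= mdist y x by rewrite s00 s0S.
have es0 : e (f s0) = 0.
  apply/eqP; rewrite eq_le e_ge0 andbT; apply/ler_addgt0Pr => c c0.
  have c40 : 0 < c / 4 by lra.
  have [s Ss sc] := inf_adherent c40 S0.
  have [hs es] := Ss.
  have := eL (f s0) (f s); rewrite es fi // ler0_norm ?subr_le0 ?s0S //.
  by rewrite -/s0 in sc; rewrite mulr2n; lra.
exists (f s0); have [e1 e2] := geodesic_from gf hs0.
have [g gg] := geodesic_path hT (f s0) z; have [g0 g1 gi] := gg.
have gfs : geodesic y (f s0) f.
  by split => //; rewrite e1 // => s t hs ht; apply: fi; lra.
have [h0 h1 hi] := gfs.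
have [|A [_ _ dyz]] := glued_geodesic hT h0 h1 g0 g1 hi gi.
  rewrite e1 => s t hs ht fg.
  have ht' := geodesic_from gg ht.
  have : e (g t) = 0.
    apply/eqP; rewrite eq_le e_ge0 andbT.
    have := metric_triangle (g t) (f s0) x.
    move: es0; rewrite /e /gp (metric_sym (g t) (f s0)); lra.
  rewrite -fg => efs; have := s0S s; rewrite /S /= efs.
  have hs' : 0 <= s <= mdist y x by lra.
  by move=> /(_ (conj hs' erefl)); lra.
split => //; rewrite /gp ?dyz.
  by rewrite (metric_sym _ y) e1 (metric_sym x y) e2; lra.
by rewrite (metric_sym _ y); lra.
Qed.

(** The Gromov product of [a] and [b] at [p] is the distance from [p] to their
    median with [p].  The medians for [a,b] and for [b,c] both lie on [p,b]; the
    nearer one lies on both [p,a] and [p,c]. *)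
Lemma rtree_tree_metric : tree_metric T.
Proof.
split; last first.
  move=> x y t ht; have [f gf] := geodesic_path hT x y.
  by exists (f t); exact: geodesic_from.
move=> p a b c.
have [m [m1 m2 m3]] := median p a b; have [n [n1 n2 n3]] := median p b c.
have tri u v w := metric_triangle (T := T) u v w.
rewrite /gp in m1 m2 m3 n1 n2 n3.
have [mn|nm] := leP (mdist p m) (mdist p n).
- left; have := between_order _ _ mn (y := b).
  rewrite /gp => /(_ m3 n1) m4.
  have := tri a m c; have := tri m n c; have := tri p m n.
  by move: (metric_sym p m) (metric_sym p n) (metric_sym a m) (metric_sym b m);
    rewrite /gp; lra.
- right; have := between_order _ _ (ltW nm) (y := b).
  rewrite /gp => /(_ n1 m3) m4.
  have := tri a n c; have := tri a m n; have := tri p n m.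
  by move: (metric_sym p m) (metric_sym p n) (metric_sym a m) (metric_sym b n)
    (metric_sym n m); rewrite /gp; lra.
Qed.

Lemma segment_between x y m : segment x y m <-> gp m x y = 0.
Proof.
have [_ _ /(_ x y)[A [hA uA _]]] := hT.
have -> : segment x y = A.
  by rewrite /segment; case: xgetP => [B _ hB|/(_ A)//]; rewrite (uA _ hB).
split=> [|/between_arc[B hB]]; last by rewrite (uA _ hB).
have [f gf] := geodesic_path hT x y.
rewrite -(uA _ (geodesic_arc gf)) => -[s + <-].
rewrite itvE => hs; have [e1 e2] := geodesic_from gf hs.
by rewrite /gp metric_sym e1 e2; lra.
Qed.

(** Two points on the same side of [x] are joined by a segment which avoids [x], so
    different components give different directions. *)
Lemma branch_point_forked x : branch_point x -> forked x.
Proof.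
rewrite /branch_point => /pcard_leP/unsquash h.
have hD i : (i < 3)%N ->
    exists y, y <> x /\ connected_component (~` [set x]) y = h i.
  move=> i3; have : directions x (h i) by exact: funS.
  by case=> y /= yx <-; exists y.
have opp i j : (i < 3)%N -> (j < 3)%N -> i <> j -> forall y z,
    y <> x -> connected_component (~` [set x]) y = h i ->
    z <> x -> connected_component (~` [set x]) z = h j -> gp x y z = 0.
  move=> i3 j3 ij y z yx hy zx hz; apply: contrapT => gp0.
  apply: ij; apply: (@inj _ _ _ h); [by rewrite inE | by rewrite inE | ].
  apply: (etrans (esym hy) (etrans _ hz)); apply: same_connected_component.
  have [f gf] := geodesic_path hT y z; have [f0 f1 fi] := gf.
  exists (f @` `[0, mdist y z]); last first.
    by exists (mdist y z) => //; rewrite itvE lexx mdist_ge0.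
  split.
  - by exists 0 => //; rewrite itvE lexx mdist_ge0.
  - move=> _ [s + <-] /= fx; rewrite itvE => hs.
    have [e1 e2] := geodesic_from gf hs; apply: gp0.
    by rewrite /gp -fx metric_sym e1 e2; lra.
  - apply: connected_continuous_connected; first exact: segment_connected.
    by apply: lipschitz_within => s t hs ht; rewrite fi.
have [a [ax ha]] := hD 0 isT.
have [b [bx hb]] := hD 1 isT.
have [c [cx hc]] := hD 2 isT.
exists a, b, c; split; first by split; apply: nesym.
by split; [apply: (opp _ _ _ _ _ _ _ ax ha bx hb)
  | apply: (opp _ _ _ _ _ _ _ bx hb cx hc)
  | apply: (opp _ _ _ _ _ _ _ ax ha cx hc)].
Qed.

End TreeGeometry.

(** * The valence of a finite subtree *)

Section TreeMetric.
Variables (R : realType) (T : metricType R).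
Implicit Types p q x y z a b c : T.

Lemma gpC p a b : gp p a b = gp p b a.
Proof. mdist_lra. Qed.

Lemma gpaa p a : gp p a a = mdist p a *+ 2.
Proof. by rewrite mulr2n; mdist_lra. Qed.

Lemma gpl p a : gp p p a = 0.
Proof. mdist_lra. Qed.

Lemma gpr p a : gp p a p = 0.
Proof. mdist_lra. Qed.

Lemma gp_ge0 p a b : 0 <= gp p a b.
Proof. by move: (dist_tri a p b); mdist_lra. Qed.

Lemma gp_le p a b : gp p a b <= mdist p a *+ 2.
Proof. by move: (dist_tri p a b); rewrite mulr2n; mdist_lra. Qed.

Lemma same_dirC p a b : same_dir p a b = same_dir p b a.
Proof. by rewrite /same_dir gpC. Qed.

Lemma same_dirxx p a : same_dir p a a = (p != a).
Proof. by rewrite /same_dir gpaa pmulrn_lgt0 // mdist_gt0. Qed.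

Lemma same_dirN p a b : ~~ same_dir p a b <-> gp p a b = 0.
Proof.
rewrite /same_dir -leNgt; split=> [le0|->//]; apply/eqP.
by rewrite eq_le le0 gp_ge0.
Qed.

Lemma same_dir_neq p a b : same_dir p a b -> p <> a.
Proof. by move=> + pa; rewrite /same_dir pa gpl ltxx. Qed.

Hypothesis hT : tree_metric T.

Lemma four_point p a b c : gp p a b <= gp p a c \/ gp p b c <= gp p a c.
Proof. by case: hT. Qed.

Lemma gp_min p a b c t : t <= gp p a b -> t <= gp p b c -> t <= gp p a c.
Proof. by move=> tab tbc; case: (four_point p a b c); exact: le_trans. Qed.

Lemma same_dir_trans p b a c : same_dir p a b -> same_dir p b c -> same_dir p a c.
Proof.
rewrite /same_dir => ab bc.
by case: (four_point p a b c); [exact: lt_le_trans ab|exact: lt_le_trans bc].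
Qed.

(** Segments from [z] to [a] and to [c] coincide up to their Gromov product. *)
Lemma between_trunc p z a c :
  gp p z a = 0 -> mdist z p *+ 2 <= gp z a c -> gp p z c = 0.
Proof.
move=> pza le_p.
have : mdist z p *+ 2 <= gp z p c.
  by apply: gp_min le_p; move: pza; rewrite mulr2n; mdist_lra.
by move: (dist_tri z p c); rewrite mulr2n; mdist_lra.
Qed.

Lemma between_inj p q z c : gp p z c = 0 -> gp q z c = 0 ->
  mdist z p = mdist z q -> p = q.
Proof.
move=> pzc qzc e; apply: mdist_positivity.
have : mdist z p *+ 2 <= gp z p q.
  apply: (@gp_min _ _ c); first by move: pzc; rewrite mulr2n; mdist_lra.
  by move: qzc e; rewrite mulr2n; mdist_lra.
by move: e; rewrite mulr2n; mdist_lra.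
Qed.

(** The four-point condition at [p]: the segments [a,b] and [b,c] cover [a,c]. *)
Lemma between_split p a b c : gp p a c = 0 -> gp p a b = 0 \/ gp p b c = 0.
Proof.
move=> pac; have [h|h] := four_point p a b c; [left|right]; apply/eqP;
  by rewrite eq_le gp_ge0 -{1}pac h.
Qed.

(** Otherwise the segment [u,v], which passes through [a], would pass through [p]
    both before and after [a]. *)
Lemma between_side p a u v : a <> p -> gp a u v = 0 ->
  same_dir p u a \/ same_dir p v a.
Proof.
move=> ap auv; apply: contrapT.
move=> /not_orP[/negP/same_dirN pua /negP/same_dirN pva].
apply: ap; apply: mdist_positivity.
by move: (dist_tri u p v) auv pua pva; mdist_lra.
Qed.

Lemma segment_param x z : exists rho : R -> T,
  [/\ forall s, 0 <= s <= mdist x z ->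
        mdist x (rho s) = s /\ gp (rho s) x z = 0,
      forall s r, 0 <= s <= r -> r <= mdist x z ->
        mdist (rho s) (rho r) = r - s
    & forall y, gp y x z = 0 -> y = rho (mdist x y)].
Proof.
have point s : exists y, 0 <= s <= mdist x z -> mdist x y = s /\ gp y x z = 0.
  have [hs|] := pselect (0 <= s <= mdist x z); last by exists x.
  have [y [xy yz]] := hT.2 x z s hs; exists y => _.
  by split => //; move: xy yz; mdist_lra.
pose rho s := sval (cid (point s)).
have rhoP s : 0 <= s <= mdist x z -> mdist x (rho s) = s /\ gp (rho s) x z = 0 :=
  svalP (cid (point s)).
exists rho; split => // [s r hs hr|y yxz].
  have [|d b] := rhoP s; first lra.
  have [|d' b'] := rhoP r; first lra.
  have : mdist x (rho s) *+ 2 <= gp x (rho s) (rho r).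
    apply: (@gp_min _ _ z); first by move: b; mdist_lra.
    by move: b' d d' hs => + -> + /andP[_]; mdist_lra.
  by have := dist_tri x (rho s) (rho r); rewrite /gp d d'; lra.
have [|d b] := rhoP (mdist x y).
  by have := dist_ge0 x y; have := dist_ge0 y z; move: yxz; mdist_lra.
by apply: between_inj yxz b _; rewrite d.
Qed.

(** The greedy choice of one point of [Z] in each direction at [y]. *)
Fixpoint dirs y (Z : seq T) : seq T :=
  if Z is z :: Z' then
    let r := dirs y Z' in
    if (y != z) && ~~ has (same_dir y z) r then z :: r else r
  else [::].

(** When [y] lies in the subtree spanned by [Z], this is its valence there. *)
Definition valence y Z : nat := size (dirs y Z).

(** The subtree spanned by [Z] is the union of the segments between its points. *)
Definition hull (Z : seq T) y : bool :=
  has (fun a => has (fun b => gp y a b == 0) Z) Z.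

Definition opposite y (E : seq T) : bool :=
  all (fun e => y != e) E && pairwise (fun a b => ~~ same_dir y a b) E.

Lemma dirs_cover y Z z : z \in Z -> y != z -> has (same_dir y z) (dirs y Z).
Proof.
elim: Z => //= w Z IH; rewrite inE => /predU1P[->|zZ] yz.
  rewrite yz /=; case: ifPn => [_|]; last by rewrite negbK.
  by rewrite /= same_dirxx yz.
by case: ifP => _ /=; rewrite IH // orbT.
Qed.

Lemma dirs_sub y Z : {subset dirs y Z <= Z}.
Proof.
elim: Z => //= w Z IH e; case: ifP => _; rewrite !inE; last first.
  by move/IH ->; rewrite orbT.
by case/predU1P => [->|/IH ->]; rewrite ?eqxx ?orbT.
Qed.

Lemma dirs_opposite y Z : opposite y (dirs y Z).
Proof.
elim: Z => //= w Z /andP[IH1 IH2]; case: ifP => [/andP[yw nw]|_]; last first.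
  by rewrite /opposite IH1.
by rewrite /opposite /= yw IH1 IH2 !andbT; move: nw; rewrite -all_predC.
Qed.

(** Points in pairwise different directions have different companions in [D]. *)
Lemma size_opposite y E D :
  opposite y E -> (forall e, e \in E -> has (same_dir y e) D) ->
  (size E <= size D)%N.
Proof.
elim: E D => //= e E IH D /andP[/= /andP[ye aE] /andP[eE pE]] cov.
have /hasP[d dD ed] := cov e (mem_head _ _).
have := size_rem dD; have D0 : (0 < size D)%N by case: (D) dD.
suff : (size E <= size (rem d D))%N by rewrite /=; lia.
apply: IH => [|e' e'E]; first by rewrite /opposite aE pE.
have /hasP[d' d'D e'd'] := cov e' (mem_behead (s := e :: E) e'E).
have dd' : d' != d.
  apply/negP => /eqP dd'; have /allP/(_ _ e'E)/negP := eE; apply.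
  by apply: same_dir_trans ed _; rewrite -dd' same_dirC.
apply/hasP; exists d' => //.
by move: d'D; rewrite (perm_mem (perm_to_rem dD)) inE (negPf dd').
Qed.

Lemma opposite_valence y E Z : opposite y E ->
  (forall e, e \in E -> has (same_dir y e) Z) -> (size E <= valence y Z)%N.
Proof.
move=> oE cov; apply: size_opposite oE _ => e /cov/hasP[z zZ ez].
have yz : y != z by apply/eqP; move: ez; rewrite same_dirC; exact: same_dir_neq.
have /hasP[d dd zd] := dirs_cover zZ yz.
by apply/hasP; exists d => //; exact: same_dir_trans ez zd.
Qed.

Lemma valence_mono y Z Z' : {subset Z <= Z'} -> (valence y Z <= valence y Z')%N.
Proof.
move=> sub; apply: opposite_valence (dirs_opposite y Z) _ => e eZ.
apply/hasP; exists e; first exact/sub/(dirs_sub eZ).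
by have /andP[/allP/(_ e eZ)] := dirs_opposite y Z; rewrite same_dirxx.
Qed.

Lemma valence_eq y Z Z' : Z =i Z' -> valence y Z = valence y Z'.
Proof.
by move=> e; apply/eqP; rewrite eqn_leq !valence_mono // => z; rewrite e.
Qed.

Lemma hullP Z y :
  reflect (exists2 ab, (ab.1 \in Z) && (ab.2 \in Z) & gp y ab.1 ab.2 = 0)
          (hull Z y).
Proof.
apply: (iffP hasP) => [[a aZ /hasP[b bZ /eqP yab]]|[[a b] /= /andP[aZ bZ] yab]].
  by exists (a, b) => //=; rewrite aZ bZ.
by exists a => //; apply/hasP; exists b => //; apply/eqP.
Qed.

Lemma hull_mono y Z Z' : {subset Z <= Z'} -> hull Z y -> hull Z' y.
Proof.
move=> sub /hullP[[a b] /= /andP[aZ bZ] yab]; apply/hullP.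
by exists (a, b) => //=; rewrite !sub.
Qed.

Lemma hull_eq y Z Z' : Z =i Z' -> hull Z y = hull Z' y.
Proof. by move=> e; apply/idP/idP; apply: hull_mono => z; rewrite e. Qed.

Lemma mem_hull y Z : y \in Z -> hull Z y.
Proof. by move=> yZ; apply/hullP; exists (y, y); rewrite /= ?yZ ?gpl. Qed.

Lemma hull_valence y Z : hull Z y -> y \notin Z -> (2 <= valence y Z)%N.
Proof.
move=> /hullP[[a b] /= /andP[aZ bZ] yab] yZ.
have neq c : c \in Z -> y != c by apply: contraTneq => <-.
have -> : 2%N = size [:: a; b] by [].
apply: opposite_valence.
  by rewrite /opposite /= !neq // !andbT; apply/same_dirN.
move=> e; rewrite !inE => /orP[] /eqP ->; apply/hasP.
  by exists a => //; rewrite same_dirxx neq.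
by exists b => //; rewrite same_dirxx neq.
Qed.

(** From outside, a subtree is seen in a single direction. *)
Lemma off_hull_valence y Z : Z != [::] -> ~~ hull Z y -> valence y Z = 1%N.
Proof.
case: Z => // z0 Z _; set Z' := z0 :: Z => off.
have z0Z : z0 \in Z' by rewrite mem_head.
have neq c : c \in Z' -> y != c.
  by move=> cZ; apply: contraNneq off => ->; exact: mem_hull.
have near c : c \in Z' -> same_dir y c z0.
  move=> cZ; apply: contraNT off => /same_dirN yc0; apply/hullP.
  by exists (c, z0); rewrite /= ?cZ.
apply/eqP; rewrite eqn_leq; apply/andP; split.
  rewrite -[1%N]/(size [:: z0]); apply: size_opposite (dirs_opposite y Z') _.
  by move=> e /dirs_sub/near /= ->.
rewrite -[1%N]/(size [:: z0]); apply: opposite_valence.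
  by rewrite /opposite /= neq.
move=> e; rewrite inE => /eqP ->; apply/hasP; exists z0 => //.
by rewrite same_dirxx neq.
Qed.

Let seq_min (f : T -> R) (Z : seq T) : Z != [::] ->
  exists2 b, b \in Z & forall c, c \in Z -> f b <= f c.
Proof.
elim: Z => // z [|w Z] IH _.
  by exists z; rewrite ?mem_head // => c; rewrite inE => /eqP ->.
have [//|b bZ bmin] := IH.
have [zb|bz] := leP (f z) (f b).
  exists z; rewrite ?mem_head // => c; rewrite inE => /predU1P[->//|cZ].
  by apply: le_trans zb _; exact: bmin.
exists b => [|c]; rewrite in_cons; first by rewrite bZ orbT.
by case/predU1P => [->|/bmin//]; exact: ltW.
Qed.

(** The projection [p] of [z] to a finite subtree ends the common part of all
    segments from [z] to this subtree. *)
Lemma hull_proj Z z : Z != [::] ->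
  exists2 p, hull Z p & forall c, c \in Z -> gp p z c = 0.
Proof.
case: Z => // a0 Z _; set Z' := a0 :: Z.
have [//|b bZ bmin] := seq_min (gp z a0) (Z := Z').
have [|p [zp pa]] := hT.2 z a0 (gp z a0 b / 2).
  by have := gp_le z a0 b; have := gp_ge0 z a0 b; rewrite mulr2n; lra.
have pza : gp p z a0 = 0 by move: zp pa; mdist_lra.
have pc c : c \in Z' -> gp p z c = 0.
  move=> /bmin le_c; apply: between_trunc pza _.
  by move: le_c; rewrite zp mulr2n; lra.
exists p => //; apply/hullP; exists (a0, b); rewrite ?mem_head ?bZ //=.
have := pc b bZ.
by move: zp pza; mdist_lra.
Qed.

(** The valence at [y] minus two, extended by zero off the subtree spanned by
    [Z].  It is the contribution of [y] to minus twice the Euler characteristic. *)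
Definition excess Z y : int :=
  if hull Z y then (valence y Z)%:Z - 2 else 0.

Lemma excess_eq Z Z' y : Z =i Z' -> excess Z y = excess Z' y.
Proof. by move=> e; rewrite /excess (hull_eq y e) (valence_eq y e). Qed.

(** Growing a subtree by a segment from [p] to [z] adds a direction at [p] and a
    terminal vertex at [z]; the interior of the segment does not contribute. *)
Lemma excess_cons Z z : Z != [::] -> exists p, forall y,
  excess (z :: Z) y = excess Z y + (y == p)%:Z - (y == z)%:Z.
Proof.
move=> Z0; have [p hp pz] := hull_proj z Z0; exists p => y.
have subZ : {subset Z <= z :: Z} by move=> w wZ; rewrite inE wZ orbT.
have hull_cons w : hull (z :: Z) w =
    [|| hull Z w, w == z | has (fun c => gp w z c == 0) Z].
  apply/idP/idP.
    move=> /hullP[[a b] /=]; rewrite !inE.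
    move=> /andP[/predU1P[->|aZ] /predU1P[->|bZ]] wab.
    - by move/eqP: wab; rewrite gpaa mulrn_eq0 /= => /eqP/mdist_positivity ->;
        rewrite eqxx orbT.
    - by apply/or3P/Or33/hasP; exists b => //; apply/eqP.
    - by apply/or3P/Or33/hasP; exists a => //; rewrite gpC; apply/eqP.
    - by apply/or3P/Or31/hullP; exists (a, b) => //=; rewrite aZ.
  case/or3P => [|/eqP ->|/hasP[c cZ /eqP wzc]]; first exact: hull_mono.
    by apply: mem_hull; rewrite mem_head.
  by apply/hullP; exists (z, c); rewrite //= mem_head subZ.
have z_hull : hull Z z -> z = p.
  move=> /hullP[[a b] /= /andP[aZ bZ] zab].
  apply/esym/mdist_positivity; move: (pz a aZ) (pz b bZ) zab.
  by move: (dist_tri a p b); mdist_lra.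
have valE w : valence w (z :: Z) =
    ((w != z) && ~~ has (same_dir w z) (dirs w Z) + valence w Z)%N.
  by rewrite /valence /=; case: ifP.
have sd_dirs w : ~~ has (same_dir w z) (dirs w Z) <->
    forall c, c \in Z -> gp w z c = 0.
  split=> [no c cZ|no].
    have [->|wc] := eqVneq w c; first exact: gpr.
    apply/same_dirN; apply: contra no => zc.
    have /hasP[d dd cd] := dirs_cover cZ wc.
    by apply/hasP; exists d => //; exact: same_dir_trans zc cd.
  by apply/hasPn => d /dirs_sub/no/same_dirN.
have [yz|yz] := eqVneq y z; last have [yp|yp] := eqVneq y p.
- rewrite /excess valE yz eqxx /= add0n (mem_hull (mem_head _ _)).
  have [zp|zp] := eqVneq z p; first by rewrite {1 2}zp hp -zp; lia.
  have nhz : ~~ hull Z z by apply: contraNN zp => /z_hull ->.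
  by rewrite (negPf nhz) off_hull_valence //; lia.
- rewrite -yp in hp pz; rewrite /excess hull_cons hp valE (negPf yz) /=.
  have -> /= : ~~ has (same_dir y z) (dirs y Z) by apply/sd_dirs.
  by lia.
- rewrite /excess valE hull_cons (negPf yz) /= addr0 subr0.
  have [hy|hy] /= := boolP (hull Z y).
    suff -> : has (same_dir y z) (dirs y Z) by [].
    apply: contraTT isT => /sd_dirs noc.
    have far u v : hull Z u -> (forall c, c \in Z -> gp u z c = 0) ->
        (forall c, c \in Z -> gp v z c = 0) -> mdist z v <= mdist z u.
      move=> /hullP[[a b] /= /andP[aZ bZ] uab] hu hv.
      move: (hu a aZ) (hu b bZ) (hv a aZ) (hv b bZ) uab.
      by move: (dist_tri a v b); mdist_lra.
    case/eqP: yp; have [c cZ] : exists c, c \in Z.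
      by case: (Z) Z0 => // c *; exists c; rewrite mem_head.
    apply: between_inj (noc c cZ) (pz c cZ) _.
    by apply/eqP; rewrite eq_le !far.
  rewrite off_hull_valence //.
  case: ifP => // /hasP[c cZ /eqP yzc].
  suff -> : ~~ has (same_dir y z) (dirs y Z) by [].
  apply/sd_dirs => c' c'Z; apply/same_dirN; apply: contraNN hy => zc'.
  apply/hullP; exists (c', c); rewrite /= ?c'Z //.
  have cc' : ~~ same_dir y c' c.
    by apply/negP => /(same_dir_trans zc'); apply/negP/same_dirN.
  exact/same_dirN.
Qed.

Definition finite_support (f : T -> int) (Y : seq T) :=
  forall y, y \notin Y -> f y = 0.

(** The Euler characteristic of a finite tree is 1.  The sum runs over any list that
    is large enough to contain all points of non-zero excess. *)
Lemma excess_sum Z : Z != [::] -> exists Y, finite_support (excess Z) Y /\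
  forall Y', uniq Y' -> {subset Y <= Y'} -> \sum_(y <- Y') excess Z y = - 2.
Proof.
have sum_eq1 (p : T) (Y' : seq T) : uniq Y' -> p \in Y' ->
    \sum_(y <- Y') (y == p)%:Z = 1 :> int.
  move=> uY pY; rewrite (bigD1_seq p) //= eqxx big1 ?addr0 // => y /negPf ->.
  by [].
elim: Z => // z [_|w Z IH] _; last first.
  have [//|Y [sY hY]] := IH.
  have [p hp] := @excess_cons (w :: Z) z isT.
  exists [:: p, z & Y]; split.
    move=> y; rewrite !inE !negb_or => /and3P[/negPf yp /negPf yz yY].
    by rewrite hp sY // yp yz.
  move=> Y' uY' sub; under eq_bigr do rewrite hp.
  rewrite sumrB big_split /= hY // ?sum_eq1 ?sub ?inE ?eqxx ?orbT //.
  by move=> y yY; rewrite sub // !inE yY !orbT.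
have eE y : excess [:: z] y = - 2 * (y == z)%:Z.
  rewrite /excess /valence /hull /= !orbF gpaa mulrn_eq0 /= andbT.
  have [->|yz] := eqVneq y z; first by rewrite mdistxx eqxx.
  by rewrite (gt_eqF (_ : 0 < mdist y z)) ?mdist_gt0.
exists [:: z]; split.
  by move=> y; rewrite inE eE => /negPf ->.
move=> Y' uY' /(_ z (mem_head _ _)) zY'.
by under eq_bigr do rewrite eE; rewrite -mulr_sumr sum_eq1.
Qed.

End TreeMetric.

(** * Finiteness of branching modulo the group *)

Section Sums.
Variables (T : eqType).

Lemma sum_support (f : T -> int) (Y Y' : seq T) : uniq Y -> uniq Y' ->
  (forall y, y \notin Y -> f y = 0) -> (forall y, y \notin Y' -> f y = 0) ->
  \sum_(y <- Y) f y = \sum_(y <- Y') f y.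
Proof.
move=> uY uY' fY fY'.
have red (A B : seq T) : (forall y, y \notin B -> f y = 0) ->
    \sum_(y <- A) f y = \sum_(y <- [seq y <- A | y \in B]) f y.
  move=> fB; rewrite big_filter [RHS]big_mkcond /=; apply: eq_bigr => y _.
  by case: ifPn => // /fB.
rewrite (red Y Y') // (red Y' Y) //; apply: perm_big; apply: uniq_perm.
- exact: filter_uniq.
- exact: filter_uniq.
- by move=> y; rewrite !mem_filter andbC.
Qed.

End Sums.

Section Actions.
Variables (R : realType) (G : groupType) (T : gspace R G).
Implicit Types (g h : G) (x y p a b : T) (Z : seq T).

Lemma gp_act g p a b : gp (act g p) (act g a) (act g b) = gp p a b.
Proof. by rewrite /gp !act_isom. Qed.

Lemma same_dir_act g p a b : same_dir (act g p) (act g a) (act g b) = same_dir p a b.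
Proof. by rewrite /same_dir gp_act. Qed.

Lemma actK g : cancel (@act _ _ T g) (act g^-1%g).
Proof. by move=> x; rewrite -actM mulVg act1. Qed.

Lemma actVK g : cancel (@act _ _ T g^-1%g) (act g).
Proof. by move=> x; rewrite -actM mulgV act1. Qed.

Lemma act_inj g : injective (@act _ _ T g).
Proof. exact: can_inj (actK g). Qed.

Lemma act_eq g x y : (act g x == act g y) = (x == y).
Proof. exact: (inj_eq (@act_inj g)). Qed.

Lemma hull_act g Z y : hull (map (@act _ _ T g) Z) (act g y) = hull Z y.
Proof.
rewrite /hull has_map; apply: eq_has => a /=; rewrite has_map.
by apply: eq_has => b /=; rewrite gp_act.
Qed.

Lemma valence_act g Z y : valence (act g y) (map (@act _ _ T g) Z) = valence y Z.
Proof.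
have E : dirs (act g y) (map (@act _ _ T g) Z) = map (@act _ _ T g) (dirs y Z).
  elim: Z => //= z Z ->; rewrite act_eq has_map.
  rewrite (eq_has (a2 := same_dir y z)); first by case: ifP.
  by move=> b /=; rewrite same_dir_act.
by rewrite /valence E size_map.
Qed.

Lemma excess_act g Z y : excess (map (@act _ _ T g) Z) (act g y) = excess Z y.
Proof. by rewrite /excess hull_act valence_act. Qed.

Lemma act_free_inj x g h : act_free T -> act g x = act h x -> g = h.
Proof.
move=> free e; apply: (mulgI h^-1%g); rewrite mulVg; apply: (free _ x).
by rewrite actM e actK.
Qed.

End Actions.

Section Index.
Variables (R : realType) (N : nat) (T : gspace R (free_group N)).
Local Notation F := (free_group N).
Hypothesis hT : tree_metric T.
Hypothesis free : act_free T.
Hypothesis spanned : forall x y : T, exists g h, gp y (act g x) (act h x) = 0.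
Implicit Types (x y p : T) (g h : F) (a : 'I_N * bool) (B : seq F).

Definition suffix_closed B :=
  forall a g, g \in B -> starts a g -> ((letter a)^-1 * g)%g \in B.

Lemma suffix_closure (L : seq F) :
  exists B, [/\ {subset L <= B}, 1%g \in B & suffix_closed B].
Proof.
elim: L => [|g L [B [LB B1 cB]]].
  exists [:: 1%g]; split => //; rewrite ?mem_head // => a g.
  by rewrite inE => /eqP ->.
suff [B' [gB' B'1 cB']] : exists B', [/\ g \in B', 1%g \in B' & suffix_closed B'].
  exists (B ++ B'); split.
  - move=> h; rewrite inE mem_cat => /predU1P[->|/LB ->//].
    by rewrite gB' orbT.
  - by rewrite mem_cat B1.
  - move=> a h; rewrite !mem_cat => /orP[hB|hB'] ah.
      by rewrite cB.
    by rewrite cB' ?orbT.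
elim/free_group_ind: g => [|a g [B' [gB' B'1 cB']]].
  exists [:: 1%g]; split; rewrite ?mem_head // => a g.
  by rewrite inE => /eqP ->.
exists ((letter a * g)%g :: B'); split; rewrite ?mem_head ?inE ?B'1 ?orbT //.
move=> b h; rewrite !inE => /predU1P[->|hB'] bh; last first.
  by rewrite (cB' b h) ?orbT.
have [ag|ag] := boolP (starts (linv a) g).
  have := cB' (linv a) g gB' ag; rewrite letterV linvK => agB'.
  by rewrite (cB' b _ agB' bh) orbT.
have : starts a (letter a * g)%g by rewrite starts_letter_mul.
by move: bh; rewrite /starts => /eqP -> /eqP[->]; rewrite mulKg gB' orbT.
Qed.

(** [K] spans a finite subtree of [T].  An edge labelled [a] joins each point [y]
    of the subtree spanned by [C a] to [(letter a)^-1 y], which also lies in the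
    subtree spanned by [K].  By freeness these edges turn the part of an orbit that
    lies in this subtree into a subforest of the Cayley tree.

    The sum of the excesses of all vertices minus those of all edges is
    [- 2 + 2 * N], by the Euler characteristics of [K] and of the [N] trees spanned
    by the sets [C a].  Now root the copy of the Cayley tree over each orbit at the
    representative of the orbit, and charge each edge to its end farther from the
    root.  As the valence along an edge is at most the valence at its ends, every
    vertex that has a parent gets a non-negative balance.  A vertex without parent
    contributes its valence minus two, which is non-negative unless it is terminal;
    but then it lies in [K], and the suffix closure of [B] provides a parent unless
    it is [x].  As the points of [Ps] are roots, they contribute their
    full excesses. *)
Section Count.
Variables (Ps : seq T) (x : T) (B : seq F).
Hypothesis xPs : x \in Ps.
Hypothesis PsN : forall p q g, p \in Ps -> q \in Ps -> act g p = q -> p = q.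
Hypothesis B1 : 1%g \in B.
Hypothesis Bletter : forall a, letter a \in B.
Hypothesis Bsuffix : suffix_closed B.

(** Orbit representatives, extending [Ps]. *)
Let rep_set y : set T := [set z | (exists g, act g z = y) /\
  (z \in Ps \/ ~ exists2 p, p \in Ps & exists g, act g p = y)].
Let rep y : T := xget x (rep_set y).

Let repP y : rep_set y (rep y).
Proof.
rewrite /rep; case: xgetP => [z _ //|none].
have [[p pPs [g gp]]|no] := pselect (exists2 p, p \in Ps & exists g, act g p = y).
  by case: (none p); split; [exists g | left].
by case: (none y); split; [exists 1%g; rewrite act1 | right].
Qed.

Let rep_act g y : rep (act g y) = rep y.
Proof.
rewrite /rep; congr xget.
have iffO z : (exists h, act h z = act g y) <-> (exists h, act h z = y).
  split=> -[h hz]; last by exists (g * h)%g; rewrite actM hz.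
  by exists (g^-1 * h)%g; rewrite actM hz actK.
apply/seteqP; split=> z [/iffO ? [?|no]]; split => //; try by left.
  by right => -[p pPs /iffO ?]; apply: no; exists p.
by right => -[p pPs /iffO ?]; apply: no; exists p.
Qed.

Let rep_Ps p : p \in Ps -> rep p = p.
Proof.
move=> pPs; have [[g gp] [rPs|[]]] := repP p; first exact: PsN gp.
by exists p => //; exists 1%g; rewrite act1.
Qed.

(** The coordinate of a point in its orbit, seen as a vertex of the Cayley tree
    rooted at the representative. *)
Let wd y : F := sval (cid (repP y).1).

Let wdP y : act (wd y) (rep y) = y.
Proof. exact: svalP (cid (repP y).1). Qed.

Let wd_act g y : wd (act g y) = (g * wd y)%g.
Proof.
apply: (act_free_inj (x := rep y)) free _.
by rewrite actM wdP -(rep_act g) wdP.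
Qed.

Let wd_Ps p : p \in Ps -> wd p = 1%g.
Proof. by move=> pPs; apply: (@free _ p); have := wdP p; rewrite rep_Ps. Qed.

Let K := [seq act g x | g <- B].
Let C a := [seq act g x | g <- B & ((letter a)^-1 * g)%g \in B].

Let C_K a : {subset C a <= K}.
Proof.
move=> _ /mapP[g + ->]; rewrite mem_filter => /andP[_ gB].
exact: map_f.
Qed.

Let K_neq0 : K != [::].
Proof. by rewrite /K; case: B B1. Qed.

Let C_neq0 a : C a != [::].
Proof.
have : act (letter a) x \in C a.
  by apply: map_f; rewrite mem_filter mulVg B1 Bletter.
by case: (C a).
Qed.

(** The edges labelled by the inverse of [a] are those labelled by [a], read
    backwards. *)
Let C_linv a : C a =i map (@act _ _ T (letter a)) (C (linv a)).
Proof.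
move=> y; apply/mapP/mapP => [[g + ->]|[_ /mapP[h + ->] ->]].
  rewrite mem_filter => /andP[lgB gB].
  exists (act (letter a)^-1%g (act g x)); last by rewrite actVK.
  rewrite -actM; apply: map_f.
  by rewrite mem_filter -letterV invgK mulVKg gB lgB.
rewrite mem_filter -letterV invgK => /andP[lhB hB].
by exists (letter a * h)%g; rewrite ?actM // mem_filter mulKg hB lhB.
Qed.

Let f a y : int := if starts a (wd y) then excess (C a) y else 0.

(** The excess of [K] at [y], minus that of the edge joining [y] to its parent. *)
Let t y : int := excess K y - \sum_a f a y.

Let sum_f_root y : wd y = 1%g -> \sum_a f a y = 0.
Proof. by move=> wy; apply: big1 => a _; rewrite /f wy. Qed.

Let sum_f_starts a y : starts a (wd y) -> \sum_b f b y = excess (C a) y.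
Proof.
move=> ay; rewrite (bigD1 a) //= big1 ?addr0 => [|b ba]; first by rewrite /f ay.
rewrite /f; case: ifP => // /eqP byE; case/eqP: ba.
by move: ay; rewrite /starts byE => /eqP[->].
Qed.

Let excess_ge0 y : y \notin K -> 0 <= excess K y.
Proof.
rewrite /excess => yK; case: ifP => // hy.
by move: (hull_valence hT hy yK); move: (valence y K); clear; lia.
Qed.

Let t_ge0 y : y \notin Ps -> 0 <= t y.
Proof.
move=> yPs.
(* A point of [K] other than [x] has a parent, since [B] is suffix closed. *)
have K_starts : y \in K -> exists2 a, starts a (wd y) & y \in C a.
  move=> /mapP[g gB yE].
  have wy : wd y = g by rewrite yE wd_act wd_Ps // mulg1.
  have [|a ag] := @starts_exists _ g.
    by move=> g1; move: yPs; rewrite yE g1 act1 xPs.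
  exists a; rewrite ?wy // yE; apply: map_f.
  by rewrite mem_filter gB Bsuffix.
have [wy|/starts_exists[a ay]] := pselect (wd y = 1%g).
  rewrite /t sum_f_root // subr0; apply: excess_ge0.
  by apply/negP => /K_starts[a]; rewrite wy.
rewrite /t (sum_f_starts ay) /excess.
have [hC|nC] := boolP (hull (C a) y).
  rewrite (hull_mono (@C_K a) hC).
  have := valence_mono hT y (@C_K a).
  by move: (valence y (C a)) (valence y K); clear; lia.
rewrite subr0 -/(excess K y); apply: excess_ge0.
apply: contra nC => /K_starts[b yb yC]; apply: mem_hull.
suff -> : a = b by [].
by move: ay yb; rewrite /starts => /eqP -> /eqP[->].
Qed.

(** Of the two ends of an edge, exactly one is farther from the root; hence each
    edge labelled [i] is charged once, either as an edge labelled [(i, false)] or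
    as an edge labelled [(i, true)]. *)
Let sum_f_pair i (Y : seq T) : uniq Y ->
  (forall a, finite_support (excess (C a)) Y) ->
  (forall a, \sum_(y <- Y) excess (C a) y = - 2) ->
  \sum_(y <- Y) f (i, false) y + \sum_(y <- Y) f (i, true) y = - 2.
Proof.
move=> uY sY hY; set a := (i, false); have -> : (i, true) = linv a by [].
pose h z : int := if starts a (wd z) then 0 else excess (C a) z.
have fh y : f (linv a) y = h (act (letter a) y).
  rewrite /f /h wd_act starts_letter_mul; case: ifP => //= _.
  by rewrite (excess_eq hT _ (C_linv a)) excess_act.
have -> : \sum_(y <- Y) f (linv a) y = \sum_(z <- map (@act _ _ T (letter a)) Y) h z.
  by rewrite big_map; apply: eq_bigr => y _; rewrite fh.
rewrite (@sum_support _ h (map (@act _ _ T (letter a)) Y) Y _ uY).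
- have : \sum_(y <- Y) (f a y + h y) = - 2.
    rewrite -(hY a); apply: eq_bigr => y _.
    by rewrite /f /h; case: ifP => _; rewrite ?addr0 ?add0r.
  by rewrite big_split.
- by rewrite map_inj_uniq //; exact: act_inj.
- move=> z zY; rewrite -(actVK (letter a) z) -fh /f sY ?if_same //.
  apply: contra zY => zY; apply/mapP; exists (act (letter a)^-1%g z) => //.
  by rewrite actVK.
- by move=> z zY; rewrite /h sY ?if_same.
Qed.

Lemma index_count : \sum_(p <- undup Ps) excess K p <= 2 * N%:Z - 2.
Proof.
have [YK [sYK hYK]] := excess_sum hT K_neq0.
have exC a : exists Y, finite_support (excess (C a)) Y /\
  forall Y', uniq Y' -> {subset Y <= Y'} ->
  \sum_(y <- Y') excess (C a) y = - 2 := excess_sum hT (C_neq0 a).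
pose YC a := sval (cid (exC a)).
pose Y := undup (Ps ++ YK ++ flatten [seq YC a | a <- enum {: 'I_N * bool}]).
have uY : uniq Y := undup_uniq _.
have YKY : {subset YK <= Y}.
  by move=> y yY; rewrite mem_undup !mem_cat yY orbT.
have YCY a : {subset YC a <= Y}.
  move=> y yY; rewrite mem_undup !mem_cat; apply/or3P/Or33/flattenP.
  by exists (YC a) => //; apply/mapP; exists a; rewrite ?mem_enum.
have sC a : finite_support (excess (C a)) Y.
  move=> y yY; have [sYC _] := svalP (cid (exC a)); apply: sYC.
  by apply: contra yY; exact: YCY.
have hC a : \sum_(y <- Y) excess (C a) y = - 2.
  by have [_] := svalP (cid (exC a)); apply => //; exact: YCY.
have sum_t : \sum_(y <- Y) t y = 2 * N%:Z - 2.
  rewrite sumrB hYK // exchange_big /=.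
  rewrite -(pair_bigA _ (fun i b => \sum_(y <- Y) f (i, b) y)) /=.
  under eq_bigr => i _ do rewrite big_bool /= addrC sum_f_pair //.
  by rewrite sumr_const card_ord -mulr_natl; lia.
rewrite -sum_t [leRHS](bigID (mem Ps)) /=.
have -> : \sum_(y <- Y | y \in Ps) t y = \sum_(p <- undup Ps) excess K p.
  rewrite -big_filter.
  rewrite (perm_big (undup Ps)) /=; last first.
    apply: uniq_perm; rewrite ?filter_uniq ?undup_uniq // => y.
    rewrite mem_filter !mem_undup mem_cat.
    by case: (y \in Ps).
  apply: eq_big_seq => p; rewrite mem_undup => pPs.
  by rewrite /t sum_f_root ?subr0 ?wd_Ps.
by rewrite lerDl sumr_ge0 // => y; exact: t_ge0.
Qed.

End Count.

(** The index inequality of Gaboriau and Levitt for free actions: count with a set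
    [B] so large that every direction in [D p] is met by some point of [B x]. *)
Theorem index_bound (Ps : seq T) (D : T -> seq T) : uniq Ps -> Ps != [::] ->
  (forall p q g, p \in Ps -> q \in Ps -> act g p = q -> p = q) ->
  (forall p, p \in Ps -> opposite p (D p) && (1 < size (D p))%N) ->
  \sum_(p <- Ps) ((size (D p))%:Z - 2) <= 2 * N%:Z - 2.
Proof.
move=> uPs + PsN hD; case: Ps uPs PsN hD => // x Ps' uPs PsN hD _.
set Ps := x :: Ps' in uPs PsN hD *.
have near p e : exists g, e != p -> same_dir p e (act g x).
  have [g [h egh]] := spanned x e.
  have [->|ep] := eqVneq e p; first by exists 1%g.
  have [|ge|he] := @between_side _ _ p e (act g x) (act h x) _ egh; first exact/eqP.
    by exists g; rewrite same_dirC.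
  by exists h; rewrite same_dirC.
pose gs p e := sval (cid (near p e)).
pose L := [seq letter a | a <- enum {: 'I_N * bool}] ++
  flatten [seq [seq gs p e | e <- D p] | p <- Ps].
have [B [LB B1 cB]] := suffix_closure L.
have Bl a : letter a \in B.
  by apply: LB; rewrite mem_cat map_f // mem_enum.
have := index_count (mem_head _ _) PsN B1 Bl cB.
rewrite undup_id //; apply: le_trans; rewrite !big_seq; apply: ler_sum => p pPs.
have /andP[oD sD] := hD p pPs.
set K := [seq act g x | g <- B].
have K0 : K != [::] by rewrite /K; case: (B) B1.
have vD : (size (D p) <= valence p K)%N.
  apply: (opposite_valence hT) => // e eD; apply/hasP; exists (act (gs p e) x).
    apply: map_f; apply: LB; rewrite mem_cat; apply/orP; right.
    apply/flattenP; exists [seq gs p e | e <- D p]; last exact: map_f.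
    by apply/mapP; exists p.
  apply: (svalP (cid (near p e))).
  by move: oD => /andP[/allP/(_ e eD)]; rewrite eq_sym.
have hp : hull K p.
  by apply: contraLR sD => /(off_hull_valence hT K0) vK; rewrite -leqNgt -vK.
rewrite /excess hp; move: vD.
by move: (size (D p)) (valence p K); clear; lia.
Qed.

End Index.

Lemma bounded_maximal (X : Type) (P : seq X -> Prop) (m : nat) :
  P [::] -> (forall s, P s -> (size s <= m)%N) ->
  exists2 s, P s & forall z, ~ P (z :: s).
Proof.
move=> P0 Pm; apply: contrapT => no.
have ext k : exists2 s, P s & size s = k.
  elim: k => [|k [s Ps sk]]; first by exists [::].
  apply: contrapT => nok; apply: no; exists s => // z Pzs.
  by apply: nok; exists (z :: s) => //=; rewrite sk.
by have [s /Pm + sm] := ext m.+1; rewrite sm ltnn.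
Qed.

Section FiniteBranching.
Variables (R : realType) (N : nat) (T : gspace R (free_group N)).
Local Notation F := (free_group N).
Hypothesis hT : tree_metric T.
Hypothesis free : act_free T.
Hypothesis spanned : forall x y : T, exists g h, gp y (act g x) (act h x) = 0.
Implicit Types (x y p q a b c : T) (g h u : F).

(** A branch point has excess at least 1, so the index inequality bounds the number
    of orbits of branch points. *)
Lemma finite_branch_orbits : exists2 s : seq T,
  (forall p, p \in s -> forked p) &
  forall p, forked p -> exists2 q, q \in s & exists g, act g p = q.
Proof.
pose P (s : seq T) := [/\ uniq s, forall p, p \in s -> forked p &
  forall p q g, p \in s -> q \in s -> act g p = q -> p = q].
have [||s [us fs ns] maxs] := @bounded_maximal T P (2 * N)%N.
- by split.
- move=> [|x s'] // [us fs ns]; set s := x :: s' in us fs ns *.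
  have triple p : exists D : seq T, forked p -> opposite p D /\ size D = 3%N.
    have [fp|] := pselect (forked p); last by exists [::].
    have [a [b [c [[/eqP pa /eqP pb /eqP pc] [ab bc ac]]]]] := fp.
    exists [:: a; b; c] => _; split => //.
    rewrite /opposite /= pa pb pc !andbT /=.
    by apply/andP; split; [apply/andP; split|]; apply/same_dirN.
  pose D p := sval (cid (triple p)).
  have DP p : p \in s -> opposite p (D p) /\ size (D p) = 3%N.
    by move=> /fs; exact: svalP (cid (triple p)).
  have := @index_bound R N T hT free spanned s D us isT ns.
  have -> : \sum_(p <- s) ((size (D p))%:Z - 2) = (size s)%:Z.
    rewrite big_seq (eq_bigr (fun=> 1)) => [|p /DP[_ ->] //].
    by rewrite -big_seq big_const_seq count_predT iter_addr_0 natz.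
  have hD p : p \in s -> opposite p (D p) && (1 < size (D p))%N.
    by move=> /DP[-> ->].
  by move=> /(_ hD); move: (size s); clear; lia.
exists s => // p fp; apply: contrapT => no; apply: (maxs p); split.
- rewrite /= us andbT; apply/negP => ps; apply: no.
  by exists p => //; exists 1%g; rewrite act1.
- by move=> q; rewrite inE => /predU1P[->|/fs].
- move=> q r g; rewrite !inE => /predU1P[->|qs] /predU1P[->|rs] //.
  + by move=> e; case: no; exists r => //; exists g.
  + by move=> e; case: no; exists q => //; exists g^-1%g; rewrite -e actK.
  + exact: ns.
Qed.

(** The index inequality for the single orbit of [p]. *)
Lemma finite_valence p : exists2 s : seq T, all (fun a => p != a) s &
  forall a, p <> a -> exists2 b, b \in s & same_dir p a b.
Proof.
have [||s os maxs] := @bounded_maximal T (opposite p) (2 * N + 2)%N.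
- by [].
- move=> s os; have [s2|] := ltnP 1 (size s); last by lia.
  have := @index_bound R N T hT free spanned [:: p] (fun=> s) isT isT.
  have h1 q r g : q \in [:: p] -> r \in [:: p] -> act g q = r -> q = r.
    by rewrite !inE => /eqP -> /eqP ->.
  have h2 q : q \in [:: p] -> opposite q s && (1 < size s)%N.
    by rewrite inE => /eqP ->; rewrite os.
  move=> /(_ h1 h2); rewrite big_seq1; move: (size s); clear; lia.
exists s; first by case/andP: os.
move=> a /eqP pa; apply: contrapT => no; apply: (maxs a).
case/andP: os => os1 os2; rewrite /opposite /= pa os1 os2 !andbT /=.
by apply/allP => b bs; apply/negP => ab; apply: no; exists b.
Qed.

(** [(p, a)] stands for the direction at [p] which contains [a]; two directions
    are compared up to the action of the group. *)
Definition dir_orbit (d e : T * T) :=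
  exists g, act g d.1 = e.1 /\ same_dir e.1 (act g d.2) e.2.

Lemma dir_orbit_sym d e : dir_orbit d e -> dir_orbit e d.
Proof.
case=> g [gd ge]; exists g^-1%g; rewrite -gd actK; split => //.
by rewrite -(same_dir_act g) actVK gd same_dirC.
Qed.

Lemma dir_orbit_trans d e k : dir_orbit d e -> dir_orbit e k -> dir_orbit d k.
Proof.
case=> g [gd ge] [h [he hk]]; exists (h * g)%g; rewrite !actM gd; split => //.
by apply: same_dir_trans hk => //; rewrite -he same_dir_act.
Qed.

Lemma finite_branch_directions : exists L : seq (T * T),
  (forall d, d \in L -> forked d.1 /\ d.1 <> d.2) /\
  forall p a, forked p -> p <> a -> exists2 d, d \in L & dir_orbit (p, a) d.
Proof.
have [s fs hs] := finite_branch_orbits.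
pose D p := s2val (cid2 (finite_valence p)).
exists (flatten [seq [seq (p, b) | b <- D p] | p <- s]); split.
  move=> _ /flattenP[_ /mapP[p ps ->] /mapP[b bD ->]] /=.
  split; first exact: fs.
  by move: (s2valP (cid2 (finite_valence p))) => /allP/(_ b bD)/eqP.
move=> p a fp pa; have [q qs [g gp]] := hs p fp.
have qga : q <> act g a by rewrite -gp => /act_inj.
have [b bD ab] := s2valP' (cid2 (finite_valence q)) _ qga.
exists (q, b); last by exists g.
apply/flattenP; exists [seq (q, b) | b <- D q]; last exact: map_f.
by apply/mapP; exists q.
Qed.

End FiniteBranching.

(** * Homotheties normalizing the action *)

Section Homotheties.
Variables (R : realType) (N : nat) (T : gspace R (free_group N)).
Local Notation F := (free_group N).
Hypothesis hT : tree_metric T.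
Hypothesis free : act_free T.
Implicit Types (x y z p q a b : T) (g h u : F) (c e : R) (H K : T -> T).
Implicit Types (Phi Psi : autg F).

(** [H] realizes the equality of [T] twisted by [Phi] with [T] rescaled by [c]. *)
Definition realizes Phi c H :=
  [/\ 0 < c, bijective H, forall x y, mdist (H x) (H y) = c * mdist x y
    & forall g x, H (act g x) = act (Phi g) (H x)].

Lemma realizes_comp Phi Psi c e H K : realizes Phi c H -> realizes Psi e K ->
  realizes (Phi * Psi)%g (c * e) (H \o K).
Proof.
move=> [c0 bH dH eH] [e0 bK dK eK]; split; first exact: mulr_gt0.
- exact: bij_comp.
- by move=> x y /=; rewrite dH dK mulrA.
- by move=> g x /=; rewrite eK eH.
Qed.

Lemma realizes_inv Phi c H : realizes Phi c H -> exists K,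
  [/\ cancel H K, cancel K H & realizes Phi^-1%g c^-1 K].
Proof.
move=> [c0 [K HK KH] dH eH]; exists K; split => //; split.
- by rewrite invr_gt0.
- by exists H.
- by move=> x y; rewrite -{2}(KH x) -{2}(KH y) dH mulKf // gt_eqF.
- move=> g x; apply: (can_inj HK); rewrite eH !KH; congr act.
  exact/esym/(autgVK Phi g).
Qed.

Lemma realizes_inner g : realizes (inng g) 1 (@act _ _ T g).
Proof.
split => //; first by exists (@act _ _ T g^-1%g) => x; rewrite ?actK ?actVK.
- by move=> x y; rewrite act_isom mul1r.
- by move=> h x /=; rewrite -!actM mulgVK.
Qed.

Lemma realizes_gp Phi c H p a b : realizes Phi c H ->
  gp (H p) (H a) (H b) = c * gp p a b.
Proof. by case=> _ _ dH _; rewrite /gp !dH mulrBr mulrDr. Qed.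

Lemma realizes_same_dir Phi c H p a b : realizes Phi c H ->
  same_dir (H p) (H a) (H b) = same_dir p a b.
Proof.
by move=> rH; rewrite /same_dir (realizes_gp _ _ _ rH) pmulr_rgt0 //; case: rH.
Qed.

Lemma realizes_neq Phi c H x y : realizes Phi c H -> x <> y -> H x <> H y.
Proof. by case=> _ /bij_inj injH _ _ xy /injH. Qed.

Lemma realizes_forked Phi c H p : realizes Phi c H -> forked p -> forked (H p).
Proof.
move=> rH [a [b [d [[pa pb pd] [ab bd ad]]]]].
exists (H a), (H b), (H d); split; first by split; apply: realizes_neq rH _.
by rewrite !(realizes_gp _ _ _ rH) ab bd ad mulr0.
Qed.

Lemma realizes_dir_orbit Phi c H p a q b : realizes Phi c H ->
  dir_orbit (p, a) (q, b) -> dir_orbit (H p, H a) (H q, H b).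
Proof.
move=> rH [g [/= gp ga]]; exists (Phi g); case: (rH) => _ _ _ eH.
by rewrite /= -!eH gp (realizes_same_dir _ _ _ rH).
Qed.

Definition pure H :=
  forall p a, forked p -> p <> a -> dir_orbit (p, a) (H p, H a).

Lemma pure_inner g : pure (@act _ _ T g).
Proof.
move=> p a _ /eqP pa; exists g; split => //=.
by rewrite same_dir_act same_dirxx.
Qed.

Lemma pure_comp Phi c H K : realizes Phi c K -> pure H -> pure K -> pure (H \o K).
Proof.
move=> rK pH pK p a fp pa; apply: dir_orbit_trans (pK p a fp pa) _ => //.
by apply: pH; [exact: realizes_forked rK fp | exact: realizes_neq rK pa].
Qed.

Lemma pure_inv Phi c H K : realizes Phi c K -> cancel K H -> pure H -> pure K.
Proof.
move=> rK KH pH p a fp pa; apply: dir_orbit_sym.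
have := pH (K p) (K a) (realizes_forked rK fp) (realizes_neq rK pa).
by rewrite !KH.
Qed.

(** Purity provides a group element for each direction at [p]; by freeness, these
    elements coincide. *)
Lemma pure_at H p : pure H -> forked p -> exists2 u, act u p = H p &
  forall a, p <> a -> same_dir (H p) (act u a) (H a).
Proof.
move=> pH fp; have [a [_ [_ [[pa _ _] _]]]] := fp.
have [u [/= up ua]] := pH p a fp pa.
exists u => // b pb; have [v [/= vp vb]] := pH p b fp pb.
suff <- : v = u by [].
by apply: (act_free_inj (x := p)) free _; rewrite up.
Qed.

Lemma pure_fixing H x a : pure H -> H x = x -> forked x -> x <> a ->
  same_dir x a (H a).
Proof.
move=> pH Hx fx xa; have [u ux ha] := pure_at pH fx.
have u1 : u = 1%g by apply: (@free _ x); rewrite ux.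
by have := ha a xa; rewrite Hx u1 act1.
Qed.

Lemma pure_normalize Phi c H x : realizes Phi c H -> pure H -> forked x ->
  exists u Psi, [/\ realizes Psi c (@act _ _ T u \o H),
    pure (@act _ _ T u \o H) & act u (H x) = x].
Proof.
move=> rH pH fx; have [u ux _] := pure_at pH fx.
exists u^-1%g, (inng u^-1 * Phi)%g; split.
- by rewrite -[c]mul1r; apply: realizes_comp rH; exact: realizes_inner.
- by apply: pure_comp rH _ pH; exact: pure_inner.
- by rewrite -ux actK.
Qed.

(** If [z] is moved, then the segments [x,z] and [x,H z] part at a branch point
    fixed by [H], at which the direction of [z] is not preserved. *)
Lemma pure_isometry_id Phi H x : realizes Phi 1 H -> pure H -> H x = x ->
  forked x -> forall z, H z = z.
Proof.
move=> rH pH Hx fx z; apply: contrapT => Hz.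
have dH y y' : mdist (H y) (H y') = mdist y y'.
  by case: rH => _ _ dH _; rewrite dH mul1r.
have xHz : mdist x (H z) = mdist x z by rewrite -{1}Hx dH.
have [|m [xm mz]] := hT.2 x z (gp x z (H z) / 2).
  by have := gp_le x z (H z); have := gp_ge0 x z (H z); rewrite mulr2n; lra.
have mxz : gp m x z = 0 by move: xm mz; mdist_lra.
have mxHz : gp m x (H z) = 0.
  by apply: (between_trunc hT mxz); rewrite xm mulr2n; lra.
have Hm : H m = m.
  apply: (between_inj hT (z := x) (c := H z)) => //.
    by rewrite -{1}Hx (realizes_gp _ _ _ rH) mxz mulr0.
  by rewrite -{1}Hx dH.
have mzHz : gp m z (H z) = 0 by move: mxz mxHz xm; mdist_lra.
have mz' : m <> z.
  move=> mz'; apply: Hz; apply/esym/mdist_positivity.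
  by move: xm xHz; rewrite mz'; mdist_lra.
have mHz : m <> H z.
  by rewrite -{1}Hm => e; apply: (realizes_neq rH mz').
have fm : forked m.
  have [<-//|/eqP mx] := eqVneq x m.
  exists x, z, (H z); split; split => //; exact/nesym.
have := pure_fixing pH Hm fm mz'.
by apply/negP/same_dirN.
Qed.

(** After normalization, [H] is the action of a group element [g], and freeness
    turns the equivariance of [H] into the equality of [Phi] with conjugation by
    [g]. *)
Lemma pure_isometry_inner Phi H x : realizes Phi 1 H -> pure H -> forked x ->
  exists g, Phi = inng g.
Proof.
move=> rH pH fx; have [u [Psi [rK pK Kx]]] := pure_normalize rH pH fx.
have id := pure_isometry_id rK pK Kx fx.
have Hu y : H y = act u^-1%g y by rewrite -{2}(id y) /= actK.
exists u^-1%g; apply: autgP => g /=.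
apply: (act_free_inj (x := H x)) free _; case: rH => _ _ _ <-.
by rewrite !Hu -!actM mulgVK.
Qed.

(** Homotheties are sorted into finitely many types, according to the way in which
    they permute the orbits of directions at branch points. *)
Lemma finite_types :
  (forall x y : T, exists g h, gp y (act g x) (act h x) = 0) ->
  exists (X : finType) (ty : (T -> T) -> X), forall Phi Psi c e H K H',
    realizes Phi c H -> realizes Psi e K -> cancel H H' -> cancel H' H ->
    ty H = ty K -> pure (H' \o K).
Proof.
move=> spanned.
have [L [fL hL]] := finite_branch_directions hT free spanned.
pose m := size L; pose d (i : 'I_m) := tnth (in_tuple L) i.
pose ty H : {ffun 'I_m -> option 'I_m} := [ffun i =>
  [pick k | `[< dir_orbit (H (d i).1, H (d i).2) (d k) >]]].
exists {ffun 'I_m -> option 'I_m}, ty => Phi Psi c e H K H' rH rK HH' H'H tyE.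
have onto p a : forked p -> p <> a -> exists i, dir_orbit (p, a) (d i).
  move=> fp pa; have [q /(tnthP (in_tuple L))[i ->] pq] := hL p a fp pa.
  by exists i.
have same i : dir_orbit (H (d i).1, H (d i).2) (K (d i).1, K (d i).2).
  have [fi ni] := fL _ (mem_tnth i (in_tuple L)).
  have := congr1 (fun f : {ffun _ -> _} => f i) tyE; rewrite !ffunE.
  case: pickP => [k /asboolP hk|none].
    by case: pickP => // k' /asboolP hk' [kk]; move: hk' hk; rewrite -kk => hk' hk;
      apply: dir_orbit_trans hk (dir_orbit_sym hk').
  have [k hk] := onto _ _ (realizes_forked rH fi) (realizes_neq rH ni).
  by have /asboolP := none k.
have [K' [HK' KH' rK']] := realizes_inv rH.
have H'E : H' =1 K' by move=> y; rewrite -{1}(KH' y) HH'.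
move=> p a fp pa /=; rewrite !H'E -{1}(HK' p) -{1}(HK' a).
apply: realizes_dir_orbit rK' _.
have [i pi] := onto p a fp pa.
have di : d i = ((d i).1, (d i).2) by case: (d i).
rewrite di in pi.
apply: dir_orbit_trans (realizes_dir_orbit rH pi) _ => //.
apply: dir_orbit_trans (same i) _ => //.
exact: dir_orbit_sym (realizes_dir_orbit rK pi).
Qed.

End Homotheties.

(** * Translations and density of orbits *)

Lemma expr_unbounded (R : realType) (c M : R) : 1 < c -> exists n, M < c ^+ n.
Proof.
move=> c1; have bern n : 1 + n%:R * (c - 1) <= c ^+ n.
  elim: n => [|n IH]; first by rewrite mul0r addr0 expr0.
  have n0 : 0 <= n%:R :> R by exact: ler0n.
  rewrite exprS; apply: le_trans (ler_wpM2l _ IH); last by lra.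
  have := mulr_ge0 n0 (sqr_ge0 (c - 1)); rewrite -natr1 expr2; lra.
have c10 : 0 < c - 1 by lra.
exists (Num.bound `|M / (c - 1)|); apply: lt_le_trans (bern _).
have := le_lt_trans (ler_norm _) (archi_boundP (normr_ge0 (M / (c - 1)))).
by rewrite ltr_pdivrMr //; lra.
Qed.

Lemma expr_small (R : realType) (c d e : R) : 0 < c < 1 -> 0 < e ->
  exists n, c ^+ n * d < e.
Proof.
move=> /andP[c0 c1] e0; have c1' : 1 < c^-1 by rewrite invf_gt1.
have [n hn] := expr_unbounded (d / e) c1'.
exists n; move: hn; rewrite exprVn ltr_pdivrMr // => hn.
by rewrite mulrC -ltr_pdivlMr ?exprn_gt0 // mulrC.
Qed.

Section Translations.
Variables (R : realType) (N : nat) (T : gspace R (free_group N)).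
Local Notation F := (free_group N).
Hypothesis hT : tree_metric T.
Hypothesis free : act_free T.
Implicit Types (x y z p q : T) (g h u : F) (c : R) (H : T -> T).

(** Otherwise the midpoints of [x, g x] and of its image would coincide. *)
Lemma translation_gt g x : g <> 1%g ->
  mdist x (act g x) < mdist x (act g (act g x)).
Proof.
move=> g1; rewrite ltNge; apply/negP => le_d.
have yg := act_isom g x (act g x).
have [|m [xm my]] := hT.2 x (act g x) (mdist x (act g x) / 2).
  by have := dist_ge0 x (act g x); lra.
have gm1 := act_isom g x m; have gm2 := act_isom g m (act g x).
apply: g1; apply: (@free _ m); apply/esym.
apply: (between_inj hT (z := act g x) (c := act g (act g x))).
- apply: (between_trunc hT (a := x)); first by move: xm my; mdist_lra.
  by move: xm my le_d yg; mdist_lra.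
- by move: gm1 gm2 yg xm my; mdist_lra.
- by move: gm1 xm my; mdist_lra.
Qed.

(** The left-hand side is a lower bound for the translation length of [g]; this is
    the four-point condition for [x], [g x], [g^2 x] and [g y]. *)
Lemma displacement_ge g x y :
  mdist x (act g (act g x)) - mdist x (act g x) <= mdist y (act g y).
Proof.
have e1 := act_isom g x y; have e2 := act_isom g x (act g x).
have e3 := act_isom g (act g x) y.
have t1 := dist_tri x y (act g y); have t2 := dist_tri (act g x) (act g y) y.
by case: (four_point hT (act g x) x (act g y) (act g (act g x)));
  move: e1 e2 e3 t1 t2; mdist_lra.
Qed.

(** An equivariant homothety scales displacements, which are bounded below. *)
Lemma equivariant_homothety c H (x : T) g : g <> 1%g -> realizes 1%g c H -> c = 1.
Proof.
move=> g1; suff small (e : R) (K : T -> T) : realizes 1%g e K -> e < 1 -> False.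
  move=> rH; have [||//] := ltgtP c 1; first by move/(small _ _ rH).
  move=> c1; have [K [_ _ rK]] := realizes_inv rH.
  have V1 : (1^-1 = 1 :> autg F)%g by exact: invg1.
  rewrite V1 in rK; case: (small _ _ rK).
  by rewrite invf_lt1 //; case: rH.
move=> [e0 _ dK eK] e1.
have iter_disp n : mdist (iter n K x) (act g (iter n K x)) =
    e ^+ n * mdist x (act g x).
  elim: n => [|n IH]; first by rewrite mul1r.
  by rewrite iterS -[act g _]/(act ((1 : autg F)%g g) _) -eK dK IH mulrA exprS.
have := translation_gt x g1; rewrite -subr_gt0 => tau.
have [|n] := @expr_small R e (mdist x (act g x)) _ _ tau; first by rewrite e0.
by rewrite -iter_disp ltNge displacement_ge.
Qed.

(** Local geodesics in trees are geodesics. *)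
Lemma local_geodesic g q n : gp (act g q) q (act g (act g q)) = 0 ->
  mdist q (act (g ^+ n)%g q) = n%:R * mdist q (act g q).
Proof.
move=> bq; have [gq|gq] := eqVneq (act g q) q.
  rewrite gq distxx mulr0; elim: n => [|n IH]; first by rewrite act1 distxx.
  by rewrite expgSr actM gq.
have upper k : mdist q (act (g ^+ k)%g q) <= k%:R * mdist q (act g q).
  elim: k => [|k IH]; first by rewrite act1 distxx mul0r.
  have := act_isom g q (act (g ^+ k)%g q); rewrite -actM -expgS.
  have := dist_tri q (act g q) (act (g ^+ k.+1)%g q).
  by rewrite -natr1 mulrDl mul1r; lra.
elim: n => [|[|n] IH]; first by rewrite act1 distxx mul0r.
  by rewrite expg1 mul1r.
have gq0 : 0 < mdist q (act g q) by rewrite mdist_gt0 eq_sym.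
have powS k : act (g ^+ k.+1)%g q = act g (act (g ^+ k)%g q).
  by rewrite expgS actM.
have q2 : same_dir (act g q) (act g (act g q)) (act (g ^+ n.+2)%g q).
  rewrite (powS n.+1) same_dir_act /same_dir.
  have := act_isom g q (act (g ^+ n)%g q); rewrite -powS.
  have := upper n; move: IH gq0; rewrite -natr1 mulrDl mul1r.
  by move: (n%:R * _); mdist_lra.
have : gp (act g q) q (act (g ^+ n.+2)%g q) = 0.
  apply/same_dirN; apply/negP; rewrite same_dirC => h.
  have := same_dir_trans hT q2 h.
  by rewrite same_dirC; apply/negP/same_dirN.
have := act_isom g q (act (g ^+ n.+1)%g q); rewrite -powS IH.
have -> : n.+2%:R = n.+1%:R + 1 :> R by rewrite natr1.
rewrite mulrDl mul1r.
by move: (n.+1%:R * _); mdist_lra.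
Qed.

(** Every point lies on the translate of a segment [x, a x], where [a] is a
    letter, hence at bounded distance from the orbit of [x]. *)
Lemma orbit_cobounded x :
  (forall x y : T, exists g h, gp y (act g x) (act h x) = 0) ->
  exists d, forall y, exists k, mdist y (act k x) <= d.
Proof.
move=> spanned; pose d := \sum_(a : 'I_N * bool) mdist x (act (letter a) x).
have d0 : 0 <= d by apply: sumr_ge0 => a _; exact: dist_ge0.
have ad a : mdist x (act (letter a) x) <= d.
  rewrite /d (bigD1 a) //= lerDl; apply: sumr_ge0 => b _; exact: dist_ge0.
exists d => y; have [g [h ygh]] := spanned x y.
suff near k w : gp w x (act k x) = 0 -> exists u, mdist w (act u x) <= d.
  have [|u hu] := near (g^-1 * h)%g (act g^-1%g y).
    by rewrite -(gp_act g) actVK -actM mulVKg.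
  by exists (g * u)%g; rewrite actM -(actVK g y) act_isom.
elim/free_group_ind: k w => [|a k IH] w.
  rewrite act1 gpaa => /eqP; rewrite mulrn_eq0 /= => /eqP/mdist_positivity ->.
  by exists 1%g; rewrite act1 distxx.
move=> /(between_split hT (act (letter a) x))[wa|wak].
  by exists 1%g; rewrite act1; move: (ad a) wa (dist_ge0 w (act (letter a) x)); mdist_lra.
have [|u hu] := IH (act (letter a)^-1%g w).
  by rewrite -(gp_act (letter a)) actVK -actM.
by exists (letter a * u)%g; rewrite actM -(actVK (letter a) w) act_isom.
Qed.

(** [H] preserves the orbit of [x], and so it contracts the bound on the distance to
    this orbit. *)
Lemma contraction_dense Phi c H x : realizes Phi c H -> c < 1 -> H x = x ->
  (forall x y : T, exists g h, gp y (act g x) (act h x) = 0) ->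
  forall y e, 0 < e -> exists k, mdist y (act k x) < e.
Proof.
move=> rH c1 Hx /(orbit_cobounded x)[d hd] y e e0.
have [c0 [K _ KH] dH eH] := rH.
have near n w : exists k, mdist w (act k x) <= c ^+ n * d.
  elim: n w => [|n IH] w; first by rewrite mul1r; exact: hd.
  have [k hk] := IH (K w); exists (Phi k).
  by rewrite -Hx -eH -(KH w) dH exprS -mulrA ler_pM2l.
have [|n hn] := @expr_small R c d e _ e0; first by rewrite c0.
by have [k hk] := near n y; exists k; apply: le_lt_trans hn.
Qed.

Lemma pure_dense Phi c H x : realizes Phi c H -> pure H -> c <> 1 -> forked x ->
  (forall x y : T, exists g h, gp y (act g x) (act h x) = 0) ->
  forall y e, 0 < e -> exists k, mdist y (act k x) < e.
Proof.
move=> rH pH c1 fx spanned.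
have [u [Psi [rK pK Kx]]] := pure_normalize hT free rH pH fx.
have [c1'|c1'|//] := ltgtP c 1; first exact: contraction_dense rK c1' Kx spanned.
have [L [KL LK rL]] := realizes_inv rK.
apply: contraction_dense rL _ _ spanned; last by rewrite -{1}Kx KL.
by rewrite invf_lt1 //; lra.
Qed.

(** Without branch points the tree would be a line, on which free isometries are
    translations, so that two letters [a] and [b] would satisfy [a b x = b a x]. *)
Lemma forked_exists : (2 <= N)%N -> T -> exists x : T, forked x.
Proof.
move=> N2 x; apply: contrapT => no_fork.
have line p q r : [\/ gp p q r = 0, gp q p r = 0 | gp r p q = 0].
  have [?|npqr] := pselect (gp p q r = 0); first exact: Or31.
  have [?|nqpr] := pselect (gp q p r = 0); first exact: Or32.
  have [?|nrpq] := pselect (gp r p q = 0); first exact: Or33.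
  exfalso.
  have [|m [pm mq]] := hT.2 p q (gp p q r / 2).
    by have := gp_le p q r; have := gp_ge0 p q r; rewrite mulr2n; lra.
  have mpq : gp m p q = 0 by move: pm mq; mdist_lra.
  have mpr : gp m p r = 0.
    by apply: (between_trunc hT mpq); rewrite pm mulr2n; lra.
  have mqr : gp m q r = 0 by move: pm mpq mpr; mdist_lra.
  apply: no_fork; exists m, p, q, r; split; split => // e.
  - by apply: npqr; rewrite -e.
  - by apply: nqpr; rewrite -e.
  - by apply: nrpq; rewrite -e.
have neq (g : F) : g <> 1%g -> x <> act g x.
  by move=> g1 /esym/free.
have straight g : g <> 1%g -> gp (act g x) x (act g (act g x)) = 0.
  move=> g1; have gt := translation_gt x g1.
  have e := act_isom g x (act g x).
  case: (line x (act g x) (act g (act g x))) => // b; exfalso; move: gt e b.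
    by move: (dist_ge0 x (act g x)); mdist_lra.
  by move: (dist_ge0 x (act g x)); mdist_lra.
pose i := Ordinal (ltnW N2); pose j := Ordinal N2.
pose a := letter (i, false); pose b0 := letter (j, false).
have ab0 : (a * b0 <> b0 * a)%g by apply: letters_not_commute.
have [b [b1 ab sab]] : exists b : F, [/\ b <> 1%g, (a * b <> b * a)%g
    & same_dir x (act a x) (act b x)].
  have b01 : b0 <> 1%g by exact: letter_neq1.
  have b01' : (b0^-1)%g <> 1%g by move/eqP; rewrite invg_eq1 => /eqP.
  have [s1|/same_dirN s1] := boolP (same_dir x (act a x) (act b0 x)); first by exists b0.
  have [s2|/same_dirN s2] := boolP (same_dir x (act a x) (act b0^-1%g x)).
    exists (b0^-1)%g; split; [exact: b01' | move=> e; apply: ab0 | exact: s2].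
    have := congr1 (fun w => b0 * (w * b0))%g e.
    by rewrite -!mulgA mulVg mulg1 mulVKg => <-.
  case: no_fork; exists x, (act a x), (act b0 x), (act b0^-1%g x); split.
    by split; apply: neq => //; exact: letter_neq1.
  by split => //; rewrite -(gp_act b0) actVK gpC; exact: straight.
have a1 : a <> 1%g by exact: letter_neq1.
have long g h : g <> 1%g -> same_dir x (act g x) (act h x) ->
    gp (act g x) x (act (g * h)%g x) = 0.
  move=> g1 gh; rewrite actM; apply/same_dirN/negP => s.
  have : same_dir (act g x) (act g (act h x)) (act g (act g x)).
    by rewrite same_dir_act same_dirC.
  by move/(same_dir_trans hT s); apply/negP/same_dirN; exact: straight.
have l1 := long a b a1 sab; have l2 : gp (act b x) x (act (b * a)%g x) = 0.
  by apply: long => //; rewrite same_dirC.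
have d1 : mdist (act a x) (act (a * b)%g x) = mdist x (act b x).
  by rewrite actM act_isom.
have d2 : mdist (act b x) (act (b * a)%g x) = mdist x (act a x).
  by rewrite actM act_isom.
have da : 0 < mdist x (act a x) by rewrite mdist_gt0; apply/eqP/neq.
have db : 0 < mdist x (act b x) by rewrite mdist_gt0; apply/eqP/neq.
have s1 : same_dir x (act (a * b)%g x) (act a x).
  by rewrite /same_dir; move: l1 d1 da; mdist_lra.
have s2 : same_dir x (act b x) (act (b * a)%g x).
  by rewrite /same_dir; move: l2 d2 db; mdist_lra.
have s : same_dir x (act (a * b)%g x) (act (b * a)%g x).
  by have := same_dir_trans hT (same_dir_trans hT s1 sab) s2.
apply: ab; apply: (act_free_inj (x := x)) free _; apply: mdist_positivity.
case: (line x (act (a * b)%g x) (act (b * a)%g x)) => e.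
- by move: s; rewrite /same_dir e ltxx.
- by move: e l1 l2 d1 d2; mdist_lra.
- by move: e l1 l2 d1 d2; mdist_lra.
Qed.

End Translations.

(** * Discreteness of the stretching factors *)

Section Pigeonhole.
Variables (R : realType) (X : Type) (v : X -> R) (P : X -> Prop).
Hypothesis small : forall e, 0 < e -> exists2 x, P x & 0 < v x < e.

Lemma decreasing_sequence e : 0 < e -> exists f : nat -> X,
  (forall n, P (f n) /\ 0 < v (f n) < e) /\
  forall i j, (i < j)%N -> v (f j) < v (f i).
Proof.
move=> e0.
have next (d : R) : exists x, 0 < d -> P x /\ 0 < v x < d.
  have [d0|nd] := pselect (0 < d).
    by have [x Px vx] := small d0; exists x.
  by have [x _ _] := small e0; exists x.
pose nx d := sval (cid (next d)).
have nxP d : 0 < d -> P (nx d) /\ 0 < v (nx d) < d := svalP (cid (next d)).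
pose f n := iter n (fun x => nx (v x)) (nx e).
have fP n : P (f n) /\ 0 < v (f n) < e.
  elim: n => [|n [_ /andP[v0 ve]]]; first exact: nxP.
  have [Pn /andP[vn vlt]] := nxP _ v0.
  by split => //; rewrite vn /=; exact: lt_trans vlt ve.
have fS n : v (f n.+1) < v (f n).
  have [_ /andP[v0 _]] := fP n.
  by have [_ /andP[]] := nxP _ v0.
exists f; split => // i j; elim: j => // j IH.
rewrite ltnS leq_eqVlt => /predU1P[->//|/IH]; exact: lt_trans.
Qed.

(** Infinitely many objects of decreasing size, sorted into finitely many types:
    two of them have the same type. *)
Lemma pigeonhole_small (Y : finType) (ty : X -> Y) e : 0 < e -> exists x y,
  [/\ P x, P y, ty x = ty y & 0 < v y < v x /\ v x < e].
Proof.
move=> /decreasing_sequence[f [fP fdec]].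
have : ~~ injectiveb (fun i : 'I_(#|Y|.+1) => ty (f i)).
  apply/negP => /injectiveP/leq_card; rewrite card_ord ltnn //.
case/injectivePn => i [j ij tij].
have main (k l : 'I_(#|Y|.+1)) : (k < l)%N -> ty (f k) = ty (f l) ->
    exists x y, [/\ P x, P y, ty x = ty y & 0 < v y < v x /\ v x < e].
  move=> kl tkl; exists (f k), (f l).
  have [Pk /andP[_ ve]] := fP k; have [Pl /andP[v0 _]] := fP l.
  by rewrite v0 fdec.
have [ltij|ltji|eij] := ltngtP i j; first exact: main tij.
  by apply: main ltji _.
by case/eqP: ij; apply: val_inj.
Qed.

End Pigeonhole.

Section Discreteness.
Variables (R : realType) (N : nat) (T : gspace R (free_group N)).
Local Notation F := (free_group N).
Hypothesis hT : tree_metric T.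
Hypothesis free : act_free T.
Implicit Types (x y z p q a b : T) (g h u : F) (c d e s t : R) (H K : T -> T).

(** Elements shifting a common segment by small amounts commute, hence lie in
    finitely many cosets of a cyclic group [<u>].  Two of them in the same coset
    differ by a power of [u], which shifts by less than [u] does. *)
Lemma no_small_shifts (rho : R -> T) (l : R) : 0 < l ->
  (forall s t, 0 <= s <= 2 * l -> 0 <= t <= 2 * l ->
     mdist (rho s) (rho t) = `|s - t|) ->
  (forall e, 0 < e -> exists2 au : R * F,
     (forall s, 0 <= s <= l -> act au.2 (rho s) = rho (s + au.1)) &
     0 < au.1 < e) -> False.
Proof.
move=> l0 iso small.
have l20 : 0 < l / 2 by lra.
have [[a u] /= shu /andP[a0 al]] := small _ l20.
have u1 : u <> 1%g.
  move=> u1; have e0 : rho 0 = rho a.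
    by rewrite -(act1 (rho 0)) -u1 shu ?add0r //; lra.
  have := iso 0 a; rewrite e0 distxx sub0r normrN gtr0_norm // => h.
  by have : 0 = a by [apply: h; lra]; lra.
pose P (bv : R * F) := (forall s, 0 <= s <= l ->
    act bv.2 (rho s) = rho (s + bv.1)) /\ 0 < bv.1 < a.
have comm bv : P bv -> commute u bv.2.
  case: bv => b v [/= shv hb]; apply: (act_free_inj (x := rho 0)) free _.
  rewrite !actM shu ?shv ?add0r ?shu ?shv; [|lra..].
  by rewrite addrC.
have coset bv : exists r, P bv ->
    (wlen r <= wlen u)%N /\ exists k, bv.2 = (expgz u k * r)%g.
  have [/comm/(centralizer_finite u1)[k [r [lr e]]]|] := pselect (P bv).
    by exists r => _; split => //; exists k.
  by exists 1%g.
pose res bv := sval (cid (coset bv)).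
have resP bv : P bv -> (wlen (res bv) <= wlen u)%N /\
    exists k, bv.2 = (expgz u k * res bv)%g := svalP (cid (coset bv)).
have smallP e : 0 < e -> exists2 bv, P bv & 0 < bv.1 < e.
  move=> e0; have [|bv shv /andP[b0]] := small (Num.min e a).
    by rewrite lt_min e0.
  by rewrite lt_min => /andP[be ba]; exists bv; rewrite ?b0 //; split; rewrite ?b0.
have [b [c [Pb Pc tbc [/andP[c0 cb] ba]]]] := pigeonhole_small smallP
  (fun bv => insub_bseq (wlen u) (fgword (res bv)) : (wlen u).-bseq _) a0.
have res_eq : res b = res c.
  apply: val_inj; move/(congr1 val): tbc.
  by rewrite !val_insubd (resP b Pb).1 (resP c Pc).1.
have [[shb _] [shc _]] := (Pb, Pc).
have [[_ [k bk]] [_ [m cm]]] := (resP b Pb, resP c Pc).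
set y := rho 0; set n := (k - m)%R.
(* As [expgz u n] commutes with [c.2], it moves [rho 0] as far as it moves
   [rho c.1], which goes to [rho b.1]. *)
have shift_n : mdist y (act (expgz u n) y) = b.1 - c.1.
  have bnc : b.2 = (expgz u n * c.2)%g.
    by rewrite bk cm mulgA -expgzD subrK res_eq.
  have cn : (expgz u n * c.2 = c.2 * expgz u n)%g.
    exact/esym/commute_expgz/esym/comm.
  rewrite -(act_isom c.2) -actM -cn -bnc shb ?shc ?add0r; [|lra..].
  by rewrite iso ?ltr0_norm; lra.
have bq : gp (act u y) y (act u (act u y)) = 0.
  rewrite shu ?add0r ?shu; [|lra..].
  rewrite /gp !iso; [|lra..].
  have -> : `|a - 0| = a by rewrite gtr0_norm; lra.
  have -> : `|a - (a + a)| = a by rewrite ltr0_norm; lra.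
  have -> : `|0 - (a + a)| = a + a by rewrite ltr0_norm; lra.
  lra.
have uy : mdist y (act u y) = a.
  by rewrite shu ?add0r ?iso ?sub0r ?normrN ?gtr0_norm //; lra.
have disp (i : nat) : mdist y (act (u ^+ i)%g y) = i%:R * a.
  by rewrite local_geodesic // uy.
have [i shi] : exists i : nat, b.1 - c.1 = i%:R * a.
  rewrite -shift_n; case: (n) => i; first by exists i; exact: disp.
  exists i.+1; rewrite -disp dist_sym -(act_isom (u ^+ i.+1)%g).
  by rewrite actVK.
case: i shi => [|i]; first by rewrite mul0r; lra.
rewrite -natr1 mulrDl mul1r => e.
by have : 0 <= i%:R * a; [rewrite mulr_ge0 ?ler0n // ltW | lra].
Qed.

End Discreteness.

Section Rays.
Variables (R : realType) (N : nat) (T : gspace R (free_group N)).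
Local Notation F := (free_group N).
Hypothesis hT : tree_metric T.
Hypothesis free : act_free T.
Hypothesis spanned : forall x y : T, exists g h, gp y (act g x) (act h x) = 0.
Implicit Types (x y z p q a b : T) (g h u : F) (c d e s t : R) (H K : T -> T).

(** Their commutator is a pure isometry. *)
Lemma pure_commute Phi Psi c e H K p : realizes Phi c H -> realizes Psi e K ->
  pure H -> pure K -> forked p -> H p = p -> K p = p ->
  forall y, H (K y) = K (H y).
Proof.
move=> rH rK pH pK fp Hp Kp y.
have [H' [HH' H'H rH']] := realizes_inv rH.
have [K' [KK' K'K rK']] := realizes_inv rK.
have := realizes_comp (realizes_comp rH' rK') (realizes_comp rH rK).
have c0 : c != 0 by rewrite gt_eqF; case: rH.
have e0 : e != 0 by rewrite gt_eqF; case: rK.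
have -> : c^-1 * e^-1 * (c * e) = 1 by rewrite mulrACA !mulVf ?mulr1.
set C := (_ \o _) => rC.
have pH' := pure_inv rH' H'H pH; have pK' := pure_inv rK' K'K pK.
have p1 := pure_comp hT rK' pH' pK'; have p2 := pure_comp hT rK pH pK.
have pC : pure C := pure_comp hT (realizes_comp rH rK) p1 p2.
have Cp : C p = p by rewrite /C /= Kp Hp -{1}Kp KK' -{1}Hp HH'.
have /= := pure_isometry_id hT free rC pC Cp fp y.
by move/(congr1 H)/(congr1 K); rewrite H'H K'K.
Qed.

(** As [H] fixes the direction of [a], the segments [p,a] and [p,H a] share an
    initial segment.  The point [z] is so near to [p] that this contains [H z]. *)
Lemma invariant_germ Phi c H p a s : realizes Phi c H -> pure H -> 1 < c ->
  forked p -> H p = p -> p <> a -> 0 < s ->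
  exists z, [/\ 0 < mdist p z <= s, gp z p a = 0 & gp z p (H z) = 0].
Proof.
move=> rH pH c1 fp Hp pa s0.
have e0 := pure_fixing free pH Hp fp pa.
set e := gp p a (H a) in e0; rewrite /same_dir -/e in e0.
have ea : e <= mdist p a *+ 2 := gp_le p a (H a).
have c0 : 0 < c by lra.
pose r := Num.min (e / (2 * c)) s.
have r0 : 0 < r by rewrite lt_min s0 andbT divr_gt0 // mulr_gt0.
have rs : r <= s by rewrite ge_min lexx orbT.
have re : c * r *+ 2 <= e.
  have : r <= e / (2 * c) by rewrite ge_min lexx.
  by rewrite ler_pdivlMr ?mulr_gt0 //; lra.
have rcr : r <= c * r by rewrite ler_peMl ?ltW.
have [|z [pz za]] := hT.2 p a r.
  by move: re rcr ea r0; lra.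
have zpa : gp z p a = 0 by move: pz za; mdist_lra.
exists z; rewrite pz r0 rs; split => //.
have zpHa : gp z p (H a) = 0.
  by apply: (between_trunc hT zpa); rewrite pz -/e; move: re rcr; lra.
have Hz : gp (H z) p (H a) = 0.
  by rewrite -{1}Hp (realizes_gp _ _ _ rH) zpa mulr0.
have dHz : mdist p (H z) = c * r.
  by case: rH => _ _ dH _; rewrite -{1}Hp dH pz.
apply: (between_trunc hT zpHa).
by move: Hz dHz pz rcr; mdist_lra.
Qed.

(** A point [z] of the ray from [p] invariant under one pure homothety [H1] lies
    on the segment from [p] to [H z] for every other expanding one: [H] commutes
    with [H1], whose powers spread a common germ over the whole ray. *)
Lemma pure_overlap Phi Psi c e H1 H p z : realizes Phi c H1 ->
  realizes Psi e H -> pure H1 -> pure H -> forked p -> H1 p = p -> H p = p ->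
  1 < c -> 1 < e -> gp z p (H1 z) = 0 -> gp z p (H z) = 0.
Proof.
move=> rH1 rH pH1 pH fp H1p Hp c1 e1 zH1.
have [<-|/eqP pz] := eqVneq p z; first exact: gpl.
have comm := pure_commute rH1 rH pH1 pH fp H1p Hp.
have dH1 y y' : mdist (H1 y) (H1 y') = c * mdist y y' by case: rH1.
have dH y y' : mdist (H y) (H y') = e * mdist y y' by case: rH.
have germ : 0 < gp p z (H z) := pure_fixing free pH Hp fp pz.
pose Z n := iter n H1 z.
have HZ n : H (Z n) = iter n H1 (H z).
  by elim: n => // n IH; rewrite /Z iterS -comm [H _]IH.
have dZ n : mdist p (Z n) = c ^+ n * mdist p z.
  elim: n => [|n IH]; first by rewrite mul1r.
  by rewrite /Z iterS -{1}H1p dH1 IH exprS mulrA.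
have gZ n : gp p (Z n) (H (Z n)) = c ^+ n * gp p z (H z).
  rewrite HZ; elim: n => [|n IH]; first by rewrite mul1r.
  by rewrite /Z !iterS -{1}H1p (realizes_gp _ _ _ rH1) IH exprS mulrA.
have zZ n : mdist p z *+ 2 <= gp p z (Z n).
  elim: n => [|n IH]; first by rewrite gpaa.
  apply: (gp_min hT) IH _.
  have bZ : gp (Z n) p (Z n.+1) = 0.
    elim: (n) => [|k IHk]; first exact: zH1.
    by have := realizes_gp (Z k) p (Z k.+1) rH1; rewrite H1p IHk mulr0.
  have : mdist p z <= mdist p (Z n).
    by rewrite dZ ler_peMl ?dist_ge0 // exprn_ege1 // ltW.
  by move: bZ; mdist_lra.
have [n hn] := expr_unbounded (mdist p z *+ 2 / gp p z (H z)) c1.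
have big : mdist p z *+ 2 <= gp p (Z n) (H (Z n)).
  by rewrite gZ -ler_pdivrMr // ltW.
have HzZ : mdist p z *+ 2 <= gp p (H (Z n)) (H z).
  rewrite -{2}Hp (realizes_gp _ _ _ rH) gpC.
  by apply: le_trans (zZ n) _; rewrite ler_peMl ?gp_ge0 // ltW.
have := gp_min hT (gp_min hT (zZ n) big) HzZ.
have := dist_tri p z (H z).
by mdist_lra.
Qed.

(** Some branch point lies inside any segment, as orbits of branch points are
    dense: project to the segment a point of such an orbit near its middle. *)
Lemma forked_between x z : forked x -> x <> z ->
  (forall y e, 0 < e -> exists k, mdist y (act k x) < e) ->
  exists p, [/\ forked p, gp p x z = 0, x <> p & p <> z].
Proof.
move=> fx xz dense; have D0 : 0 < mdist x z by rewrite mdist_gt0; apply/eqP.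
have [|m [xm mz]] := hT.2 x z (mdist x z / 2); first by lra.
have [|k mk] := dense m (mdist x z / 4); first by lra.
set w := act k x in mk.
have fw : forked w.
  by apply: realizes_forked (realizes_inner T k) fx.
have t1 := dist_tri x w m; have t2 := dist_tri x m w.
have t3 := dist_tri z m w; have t4 := dist_tri z w m.
have gp0 := gp_ge0 x z w.
have [|p [xp pz]] := hT.2 x z (gp x z w / 2).
  by have := gp_le x z w; lra.
have pxz : gp p x z = 0 by move: xp pz; mdist_lra.
have pxw : gp p x w = 0 by apply: (between_trunc hT pxz); rewrite xp; lra.
have pzw : gp p z w = 0 by move: xp pxz pxw; mdist_lra.
have xp' : x <> p.
  move=> e; move: xp t1 t2 t3 t4 mk xm mz D0; rewrite -e; clearbody w.
  by mdist_lra.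
have pz' : p <> z.
  move=> e; move: xp t1 t2 t3 t4 mk xm mz D0; rewrite e; clearbody w.
  by mdist_lra.
exists p; split => //.
have [->//|/eqP pw] := eqVneq p w.
by exists x, z, w; split; split => //; exact: nesym.
Qed.

(** Suppose that [H] fixes [x], that [u] moves [p] as [H] does, and that both [H]
    and [u^-1 H] expand the relevant segments along themselves.  Then [u q] lies on
    the segment [H p,H q], at the same distance from [H p] as [q] from [p], and
    [H p,H q] lies on [x,z].  So [u] shifts the segment [p,q] along [x,z], by the
    amount by which [H] moves [p]. *)
Lemma overlap_shift Phi c H u x z p q : realizes Phi c H -> H x = x ->
  act u p = H p -> gp z x (H z) = 0 -> gp p x z = 0 -> gp q p z = 0 ->
  gp q p (act u^-1%g (H q)) = 0 -> 1 < c -> c * mdist x q <= mdist x z ->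
  forall y, gp y p q = 0 -> gp (act u y) x z = 0 /\
    mdist x (act u y) = mdist x y + (c - 1) * mdist x p.
Proof.
move=> [c0 _ dH _] Hx up zH pxz qpz quH c1 le_z y ypq.
have [xq qxz] : mdist x q = mdist x p + mdist p q /\ gp q x z = 0.
  have t1 := dist_tri x q z; have t2 := dist_tri x p q.
  by split; move: t1 t2 pxz qpz; mdist_lra.
have dHx w : mdist x (H w) = c * mdist x w by rewrite -{1}Hx dH.
have Hxz w : gp w x z = 0 -> c * mdist x w <= mdist x z -> gp (H w) x z = 0.
  move=> wxz le_w; apply: (between_trunc hT (a := H z)).
    by rewrite -{1}Hx /gp !dH -mulrDr -mulrBr [X in _ * X]wxz mulr0.
  by rewrite dHx; move: zH le_w; mdist_lra.
have le_pz : c * mdist x p <= mdist x z.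
  apply: le_trans le_z; rewrite ler_pM2l // xq lerDl; exact: dist_ge0.
have Hpx := Hxz p pxz le_pz; have Hqx := Hxz q qxz le_z.
have uq : gp (act u q) (H p) (H q) = 0.
  by rewrite -up -(actVK u (H q)) gp_act.
have dup w : mdist (H p) (act u w) = mdist p w by rewrite -up act_isom.
have duq : mdist (act u y) (act u q) = mdist y q by rewrite act_isom.
have dHpq : mdist (H p) (H q) = c * mdist p q by [].
have xpy : mdist x y = mdist x p + mdist p y.
  have := dist_tri x y q; have := dist_tri x p y.
  by move: ypq xq; mdist_lra.
have t1 := dist_tri x (H p) (act u q); have t2 := dist_tri x (act u q) (H q).
have t3 := dist_tri (act u q) (H q) z; have t4 := dist_tri x (act u q) z.
have t5 := dist_tri x (H p) (act u y); have t6 := dist_tri x (act u y) z.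
have t7 := dist_tri (act u y) (act u q) z.
have cxq : c * mdist x q = c * mdist x p + c * mdist p q by rewrite xq mulrDr.
have xuq : mdist x (act u q) = c * mdist x p + mdist p q.
  by move: t1 t2 uq (dup q) (dHx p) (dHx q) dHpq cxq; mdist_lra.
have uqz : gp (act u q) x z = 0.
  by move: t3 t4 uq Hqx xuq (dup q) (dHx q) dHpq cxq; mdist_lra.
rewrite xpy mulrBl mul1r.
by split; move: t5 t6 t7 uqz xuq ypq (dup y) (dHx p) duq; mdist_lra.
Qed.

(** If expansion factors of pure homotheties accumulated at 1, then the shifts of
    the previous lemma would be arbitrarily small on a fixed segment. *)
Lemma pure_gap : (exists x : T, forked x) -> exists2 e, 0 < e &
  forall Phi c H, realizes Phi c H -> pure H -> 1 < c -> 1 + e <= c.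
Proof.
move=> [x fx]; apply: contrapT => nogap.
have small e : 0 < e -> exists Phi c H,
    [/\ realizes Phi c H, pure H, H x = x, 1 < c & c < 1 + e].
  move=> e0; apply: contrapT => no; apply: nogap; exists e => // Phi c H rH pH c1.
  rewrite leNgt; apply/negP => ce; apply: no.
  have [u [Psi [rK pK Kx]]] := pure_normalize hT free rH pH fx.
  by exists Psi, c, (@act _ _ T u \o H).
have [Phi1 [c1 [H1 [rH1 pH1 H1x c11 _]]]] := small 1 ltr01.
have c1n : c1 <> 1 by lra.
have dense := pure_dense hT free rH1 pH1 c1n fx spanned.
have [a [_ [_ [[xa _ _] _]]]] := fx.
have [z [/andP[xz0 _] _ zH1]] := invariant_germ rH1 pH1 c11 fx H1x xa ltr01.
have xz : x <> z by apply/eqP; rewrite -mdist_gt0.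
have [p [fp pxz xp pz]] := forked_between fx xz dense.
have [u1 [Psi1 [rG pG Gp]]] := pure_normalize hT free rH1 pH1 fp.
have pz0 : 0 < mdist p z / 2 by rewrite divr_gt0 // mdist_gt0; apply/eqP.
have [q [/andP[l0 le_l] qpz qG]] := invariant_germ rG pG c11 fp Gp pz pz0.
have t0 : 0 < mdist x p by rewrite mdist_gt0; apply/eqP.
have [rho [rhoP rho_dist rho_inj]] := segment_param hT x z.
have [xq qxz] : mdist x q = mdist x p + mdist p q /\ gp q x z = 0.
  have t1 := dist_tri x q z; have t2 := dist_tri x p q.
  by split; move: t1 t2 pxz qpz; mdist_lra.
have le_z : mdist x p + 2 * mdist p q <= mdist x z.
  by move: le_l pxz; mdist_lra.
have pE := rho_inj p pxz; have qE := rho_inj q qxz; rewrite xq in qE.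
have shift Phi c H : realizes Phi c H -> pure H -> H x = x -> 1 < c ->
    (c - 1) * mdist x q < mdist p q -> exists u, forall y, gp y p q = 0 ->
    gp (act u y) x z = 0 /\
    mdist x (act u y) = mdist x y + (c - 1) * mdist x p.
  move=> rH pH Hx cgt1 cq; have [u up _] := pure_at free pH fp; exists u.
  have rK := realizes_comp (realizes_inner T u^-1%g) rH.
  have pK := pure_comp hT rH (@pure_inner _ _ T u^-1%g) pH.
  have Kp : (@act _ _ T u^-1%g \o H) p = p by rewrite /= -up actK.
  rewrite mul1r in rK.
  have qK := pure_overlap rG rK pG pK fp Gp Kp c11 cgt1 qG.
  have zH := pure_overlap rH1 rH pH1 pH fx H1x Hx c11 cgt1 zH1.
  apply: overlap_shift rH Hx up zH pxz qpz qK cgt1 _.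
  by move: cq le_z; rewrite mulrBl mul1r xq; clear; lra.
clear zH1 qG rG pG Gp rH1 pH1 H1x dense nogap.
move: l0 t0 le_z pE qE shift; rewrite xq.
set t := mdist x p; set l := mdist p q => l0 t0 le_z pE qE shift.
clearbody t l; clear xq qxz qpz pz0 le_l xp pz.
apply: (@no_small_shifts R N T hT free (fun s => rho (t + s)) l l0).
  move=> s r hs hr; have [sr|rs] := leP s r.
    by rewrite rho_dist; [rewrite ler0_norm; lra|lra|lra].
  by rewrite dist_sym rho_dist; [rewrite gtr0_norm; lra|lra|lra].
move=> e e0; have [|Phi [c [H [rH pH Hx cgt1 clt]]]] :=
  small (Num.min (e / t) (l / (t + l))).
  by rewrite lt_min !divr_gt0 //; lra.
have /andP[ce cl] : (c - 1 < e / t) && (c - 1 < l / (t + l)).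
  by rewrite -lt_min; lra.
rewrite ltr_pdivlMr // in ce; rewrite ltr_pdivlMr in cl; last by lra.
have [u hu] := shift Phi c H rH pH Hx cgt1 cl.
exists ((c - 1) * t, u); last by rewrite /= ce mulr_gt0 // subr_gt0.
move=> s hs /=.
have [|ds bs] := rhoP (t + s); first lra.
have [|b d] := hu (rho (t + s)).
  by rewrite pE qE /gp dist_sym !rho_dist; lra.
by rewrite (rho_inj _ b) d ds addrA.
Qed.

End Rays.

Section Gap.
Variables (R : realType) (N : nat) (T : gspace R (free_group N)).
Local Notation F := (free_group N).
Hypothesis hT : tree_metric T.
Hypothesis free : act_free T.
Hypothesis spanned : forall x y : T, exists g h, gp y (act g x) (act h x) = 0.
Hypothesis forked_ex : exists x : T, forked x.

(** If the factors of homotheties accumulated at 1, then so would those of pure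
    homotheties, as ratios of factors of two homotheties of the same type. *)
Lemma stretch_gap : exists2 e : R, 0 < e &
  forall Phi c (H : T -> T), realizes Phi c H -> 1 < c -> 1 + e <= c.
Proof.
have [e e0 gap] := pure_gap hT free spanned forked_ex.
have [X [ty tyP]] := finite_types hT free spanned.
apply: contrapT => nogap.
pose P (t : autg F * R * (T -> T)) := realizes t.1.1 t.1.2 t.2.
have small d : 0 < d -> exists2 t, P t & 0 < t.1.2 - 1 < d.
  move=> d0; apply: contrapT => no; apply: nogap; exists d => // Phi c H rH c1.
  rewrite leNgt; apply/negP => cd; apply: no; exists (Phi, c, H) => //=.
  by apply/andP; split; lra.
have [[[Phi c] H] [[[Psi d] K] [/= rH rK tyHK [/andP[d1 dc] ce]]]] :=
  pigeonhole_small small (fun t => ty t.2) e0.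
have {}rH : realizes Phi c H := rH; have {}rK : realizes Psi d K := rK.
have [K' [KK' K'K rK']] := realizes_inv rK.
have pC := tyP _ _ _ _ _ _ _ rK rH KK' K'K (esym tyHK).
have := gap _ _ _ (realizes_comp rK' rH) pC.
have d0 : 0 < d by lra.
rewrite mulrC ltr_pdivlMr // ler_pdivlMr // mul1r => /(_ _) le_c.
by have : (1 + e) * d <= c; [apply: le_c; lra | nra].
Qed.

(** Two powers of [H] have the same type. *)
Lemma pure_exists Phi c (H : T -> T) : realizes Phi c H -> 1 < c ->
  exists Psi d (K : T -> T), [/\ realizes Psi d K, pure K & d <> 1].
Proof.
move=> rH c1; have [X [ty tyP]] := finite_types hT free spanned.
have c0 : 0 < c by lra.
have rn n : exists Psi, realizes Psi (c ^+ n) (iter n H).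
  elim: n => [|n [Psi rn]].
    exists 1%g; split; rewrite ?expr0 //; first by exists id.
    by move=> x y; rewrite mul1r.
  by exists (Phi * Psi)%g; rewrite exprS; exact: (realizes_comp rH rn).
have small d : 0 < d -> exists2 n : nat, True & 0 < c^-1 ^+ n < d.
  move=> d0; have [|n hn] := @expr_small R c^-1 1 d _ d0.
    by rewrite invr_gt0 c0 invf_lt1.
  by exists n => //; rewrite exprn_gt0 ?invr_gt0 //= -[X in X < _]mulr1.
have [n [m [_ _ tynm [/andP[_ mn] _]]]] :=
  pigeonhole_small small (fun n => ty (iter n H)) ltr01.
have [[Psi rPsi] [Theta rTheta]] := (rn n, rn m).
have [K [HK KH rK]] := realizes_inv rPsi.
have pC := tyP _ _ _ _ _ _ _ rPsi rTheta HK KH tynm.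
exists (Psi^-1 * Theta)%g, ((c ^+ n)^-1 * c ^+ m), (K \o iter m H).
split => //; first exact: realizes_comp.
have cn := exprn_gt0 n c0.
move=> e1; move: mn; rewrite !exprVn.
have -> : c ^+ m = c ^+ n; last by rewrite ltxx.
by rewrite -[LHS](mulKf (x := (c ^+ n)^-1)) ?invr_eq0 ?gt_eqF // e1 invrK mulr1.
Qed.

End Gap.

(** The segments between points of the orbit of [x] cover an invariant subtree. *)
Lemma minimal_spanned (R : realType) (G : groupType) (T : gspace R G) :
  rtree T -> act_minimal T ->
  forall x y : T, exists g h, gp y (act g x) (act h x) = 0.
Proof.
move=> rT minT x y; have hT := rtree_tree_metric rT.
pose S : set T := [set w | exists g h, gp w (act g x) (act h x) = 0].
suff ST : S = [set: T] by have : S y by rewrite ST.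
apply: minT; last first.
  by move=> g w [a [b wab]]; exists (g * a)%g, (g * b)%g; rewrite !actM gp_act.
split; first by exists x, 1%g, 1%g; rewrite act1 gpl.
move=> u v [a [b uab]] [a' [b' vab]] w /(segment_between rT) wuv.
have [->|/eqP/nesym uw] := eqVneq w u; first by exists a, b.
have [->|/eqP/nesym vw] := eqVneq w v; first by exists a', b'.
have opp k k' : same_dir w (act k x) u -> same_dir w (act k' x) v -> S w.
  move=> su sv; exists k, k'; apply/same_dirN/negP => s.
  rewrite same_dirC in su; have := same_dir_trans hT (same_dir_trans hT su s) sv.
  by apply/negP/same_dirN.
by case: (between_side uw uab) => su; case: (between_side vw vab) => sv;
  apply: opp su sv.
Qed.

(** * Stabilizers *)

Section Stabilizer.
Variables (R : realType) (N : nat) (T : gspace R (free_group N)).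
Local Notation F := (free_group N).
Local Open Scope quotient_scope.
Hypothesis N2 : (2 <= N)%N.
Hypothesis cT : cvbar T.
Hypothesis free : act_free T.
Implicit Types (phi psi : outg F) (c e : R).

Let rT : rtree T. Proof. by case: cT. Qed.
Let hT : tree_metric T := rtree_tree_metric rT.
Let spanned : forall x y : T, exists g h, gp y (act g x) (act h x) = 0.
Proof. by apply: minimal_spanned => //; case: cT. Qed.
Let base : exists x : T, True.
Proof. by case: cT => _ [x _] _ _; exists x. Qed.
Let forked_ex : exists x : T, forked x.
Proof. by have [x _] := base; exact: forked_exists. Qed.

(** [phi] stabilizes the class of [T], with stretching factor [c]. *)
Definition stretches phi c := exists Phi (H : T -> T),
  \pi_(outg F) Phi = phi /\ realizes Phi c H.

Lemma stretches_gt0 phi c : stretches phi c -> 0 < c.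
Proof. by case=> Phi [H [_ []]]. Qed.

(** The quotient of two realizations, corrected by an inner automorphism, is an
    equivariant homothety. *)
Lemma stretches_unique phi c e : stretches phi c -> stretches phi e -> c = e.
Proof.
move=> [Phi [H [<- rH]]] [Psi [K [/esym/Defs.eq_piP[g PhiE] rK]]].
have [x _] := base.
have [L [KL LK rL]] := realizes_inv rK.
have rC := realizes_comp rL (realizes_comp (realizes_inner T g^-1%g) rH).
have Psi1 : (Psi^-1 * (inng g^-1 * Phi))%g = 1%g.
  have -> : (inng g^-1 * Phi)%g = Psi; last exact: mulVg.
  by apply: autgP => w /=; rewrite PhiE invgK !mulgA mulVg mul1g mulgVK.
rewrite Psi1 in rC.
have := equivariant_homothety hT free x (@letter_neq1 N (Ordinal N2, true)) rC.
rewrite mul1r => e1; have e0 : e != 0 by rewrite gt_eqF //; case: rK.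
by rewrite -[c]mul1r -(divff e0) -mulrA e1 mulr1.
Qed.

Lemma stretches1 : stretches 1%g 1.
Proof.
exists 1%g, id; split => //; split => //; first by exists id.
by move=> x y; rewrite mul1r.
Qed.

Lemma stretchesM phi psi c e :
  stretches phi c -> stretches psi e -> stretches (phi * psi)%g (c * e).
Proof.
move=> [Phi [H [<- rH]]] [Psi [K [<- rK]]].
exists (Phi * Psi)%g, (H \o K); split; last exact: realizes_comp.
exact: esym (Defs.pi_mul Phi Psi).
Qed.

Lemma stretchesV phi c : stretches phi c -> stretches phi^-1%g c^-1.
Proof.
move=> [Phi [H [<- rH]]]; have [K [_ _ rK]] := realizes_inv rH.
by exists Phi^-1%g, K; split => //; exact: esym (Defs.pi_inv Phi).
Qed.

Lemma stretches_expgz phi c n : stretches phi c -> stretches (expgz phi n) (c ^ n).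
Proof.
move=> hphi; have pos m : stretches (phi ^+ m)%g (c ^+ m).
  elim: m => [|m IH]; first by rewrite expg0 expr0; exact: stretches1.
  by rewrite expgS exprS; exact: stretchesM.
by case: n => m; [exact: pos | exact/stretchesV/pos].
Qed.

Lemma equi_isometric_stretches phi (c : {posnum R}) :
  equi_isometric (out_twist T phi) (gscale c T) <-> stretches phi c%:num.
Proof.
split=> [[f [[H fH Hf] df ef]]|].
  exists (repr phi), H; split; first exact: reprK.
  split => //; first by exists f.
  - by move=> x y; rewrite -[RHS]/(mdist (x : gscale c T) y) -{2}(Hf x) -{2}(Hf y) df.
  - by move=> g x; apply: (can_inj fH); rewrite Hf; have := ef g (H x);
      rewrite /= Hf => ->.
move=> [Phi [H [pi_phi rH]]].
have /Defs.eq_piP[g PhiE] : \pi_(outg F) (repr phi) = \pi_(outg F) Phi.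
  by rewrite reprK pi_phi.
have {rH} := realizes_comp (realizes_inner T g) rH.
have -> : (inng g * Phi)%g = repr phi by apply: autgP => w; rewrite PhiE.
rewrite mul1r => rK; have [L [KL LK [_ _ dL eL]]] := realizes_inv rK.
exists L; split.
- by exists (@act _ _ T g \o H).
- move=> x y; rewrite -[LHS]/(c%:num * mdist (L x) (L y)) dL.
  by rewrite mulVKf // gt_eqF.
- move=> w x; apply: etrans (eL (repr phi w) x) _; congr act.
  exact: (autgK (repr phi) w).
Qed.

Lemma stabCV_stretches phi : stabCV T phi <-> exists c, stretches phi c.
Proof.
rewrite (stabCV_P phi cT); split=> [[c /equi_isometric_stretches]|[c hc]].
  by exists c%:num.
exists (PosNum (stretches_gt0 hc)); exact/equi_isometric_stretches.
Qed.

Lemma stretchE phi c : stretches phi c -> (stretch T phi)%:num = c.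
Proof.
move=> hc; rewrite /stretch; case: xgetP => [d _ /equi_isometric_stretches hd|none].
  exact: stretches_unique hd hc.
case: (none (PosNum (stretches_gt0 hc))).
exact/equi_isometric_stretches.
Qed.

Lemma stretch_kernelE phi : stretch_kernel T phi <-> stretches phi 1.
Proof.
split=> [[/stabCV_stretches[c hc]]|h1].
  by rewrite (stretchE hc) => <-.
by split; [apply/stabCV_stretches; exists 1 | exact: stretchE].
Qed.

(** Isometries of the same type differ by a pure isometry, which is inner. *)
Lemma stretch_kernel_finite : finite_set (stretch_kernel T).
Proof.
have [X [ty tyP]] := finite_types hT free spanned.
have [x fx] := forked_ex.
pose Q (t : X) : set (outg F) := [set phi | exists Phi (H : T -> T),
  [/\ \pi_(outg F) Phi = phi, realizes Phi 1 H & ty H = t]].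
apply: (@sub_finite_set _ _ [set xget 1%g (Q t) | t in [set: X]]); last first.
  exact: finite_image.
move=> phi /stretch_kernelE[Phi [H [pi_phi rH]]]; exists (ty H) => //.
case: xgetP => [psi _ [Psi [K [<- rK tyK]]]|none]; last first.
  by case: (none phi); exists Phi, H.
have [K' [KK' K'K rK']] := realizes_inv rK.
have pC := tyP _ _ _ _ _ _ _ rK rH KK' K'K tyK.
have := realizes_comp rK' rH; rewrite invr1 mul1r => rC.
have [g PhiE] := pure_isometry_inner hT free rC pC fx.
rewrite -pi_phi; apply/Defs.eq_piP; exists (Psi g^-1%g) => w.
have := congr1 (fun A : autg F => Psi (A w)) PhiE.
rewrite /= autgVK => ->.
rewrite !autg_morph autgV invgK !mulgA mulVg mul1g.
by rewrite mulgVK.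
Qed.

Lemma stabCV_subgroup : is_subgroup (stabCV T).
Proof.
split; first by apply/stabCV_stretches; exists 1; exact: stretches1.
- move=> phi psi /stabCV_stretches[c hc] /stabCV_stretches[e he].
  by apply/stabCV_stretches; exists (c * e); exact: stretchesM.
- move=> phi /stabCV_stretches[c hc].
  by apply/stabCV_stretches; exists c^-1; exact: stretchesV.
Qed.

Lemma stretch_kernel_normal : normal_subgroup (stretch_kernel T) (stabCV T).
Proof.
split.
- split; first by apply/stretch_kernelE; exact: stretches1.
  + move=> phi psi /stretch_kernelE h1 /stretch_kernelE h2.
    by apply/stretch_kernelE; rewrite -[1]mulr1; exact: stretchesM.
  + move=> phi /stretch_kernelE h1.
    by apply/stretch_kernelE; rewrite -invr1; exact: stretchesV.
- by move=> phi [].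
- move=> phi p /stabCV_stretches[c hc] /stretch_kernelE hp.
  apply/stretch_kernelE; have c0 : c != 0 by rewrite gt_eqF ?(stretches_gt0 hc).
  rewrite -(divff c0) -{1}[c]mulr1.
  by apply: stretchesM; [exact: stretchesM | exact: stretchesV].
Qed.

(** The stretching factors greater than 1 have a least element, which generates
    the group of all stretching factors. *)
Lemma stretch_generator : ~ (stabCV T `<=` stretch_kernel T) ->
  exists phi c, [/\ stretches phi c, 1 < c &
    forall psi, stabCV T psi -> exists n, stretch_kernel T (psi * expgz phi n)%g].
Proof.
move=> notP.
have [e e0 gap] := stretch_gap hT free spanned forked_ex.
have {}gap phi c : stretches phi c -> 1 < c -> 1 + e <= c.
  by move=> [Phi [H [_ rH]]]; exact: gap rH.
pose S : set R := [set c | 1 < c /\ exists phi, stretches phi c].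
have [c0 [c01 [phi0 h0]]] : exists c, S c.
  have [phi [/stabCV_stretches[c hc] nphi]] :
      exists phi, stabCV T phi /\ ~ stretch_kernel T phi.
    by apply: contrapT => no; apply: notP => phi sphi;
      apply: contrapT => nphi; apply: no; exists phi.
  have c0 := stretches_gt0 hc.
  have [c1|c1|c1] := ltgtP c 1.
  - exists c^-1; split; first by rewrite invf_gt1.
    by exists phi^-1%g; exact: stretchesV.
  - by exists c; split => //; exists phi.
  - by case: nphi; apply/stretch_kernelE; rewrite -c1.
have infS : has_inf S.
  by split; [exists c0; split => //; exists phi0 | exists 1 => c [/ltW]].
have m1 : 1 <= inf S.
  by apply: lb_le_inf; [case: infS | move=> c [/ltW]].
have le_inf c : S c -> inf S <= c by move=> Sc; apply: ge_inf => //; case: infS.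
have m0 : 0 < inf S * e by rewrite mulr_gt0 //; lra.
have [c [c1 [phi hc]] cm] := inf_adherent m0 infS.
have c_min d : S d -> c <= d.
  move=> Sd; have [d1 [psi hd]] := Sd; rewrite leNgt; apply/negP => dc.
  have d0 : 0 < d by lra.
  have := gap _ _ (stretchesM hc (stretchesV hd)).
  rewrite ltr_pdivlMr // ler_pdivlMr // mul1r => /(_ dc).
  have := le_inf d Sd; have : inf S * e <= d * e by rewrite ler_pM2r ?le_inf.
  by move: cm; lra.
exists phi, c; split => // psi /stabCV_stretches[d hd].
have cgt0 : 0 < c by lra.
have main psi' d' : stretches psi' d' -> 1 <= d' ->
    exists n, stretch_kernel T (psi' * expgz phi n)%g.
  move=> hd' d1; have ex : exists n, d' < c ^+ n by exact: expr_unbounded.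
  case: (ex_minnP ex) => [[|n]]; first by rewrite expr0; lra.
  move=> dn nmin; exists (- n%:Z).
  have cn : c ^+ n <= d' by rewrite leNgt; apply/negP => /nmin; rewrite ltnn.
  have hn := stretchesM hd' (stretches_expgz (- n%:Z) hc).
  have cn0 : 0 < c ^+ n by exact: exprn_gt0.
  have cnE : c ^ (- n%:Z) = (c ^+ n)^-1 by rewrite -invr_expz.
  rewrite cnE in hn.
  apply/stretch_kernelE; suff <- : d' / c ^+ n = 1 by [].
  apply: contrapT => ne1.
  have gt1 : 1 < d' / c ^+ n.
    by rewrite lt_neqAle ler_pdivlMr // mul1r cn andbT eq_sym; apply/eqP.
  have : c <= d' / c ^+ n by apply: c_min; split => //; exists (psi' * expgz phi (- n%:Z))%g.
  by rewrite ler_pdivlMr // -exprS leNgt dn.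
have [d1|d1] := leP 1 d; first exact: main hd d1.
have [|n hn] := main _ _ (stretchesV hd).
  by rewrite ltW // invf_gt1 ?(stretches_gt0 hd).
have [[_ _ inv] _ nrm] := stretch_kernel_normal.
exists (- n)%R; have := inv _ hn; rewrite invgM invgK -expgzN => hn'.
have sphi : stabCV T (expgz phi n).
  by apply/stabCV_stretches; exists (c ^ n); exact: stretches_expgz.
by have := nrm _ _ sphi hn'; rewrite -expgzN !mulgA -expgzD subrr mul1g.
Qed.

End Stabilizer.

(** * Virtually cyclic groups *)

Section VirtuallyCyclic.
Variable G : groupType.

Lemma cyclic_trivial : cyclic_subgroup [set (1 : G)]%g.
Proof.
exists 1%g; apply/seteqP; split=> [_ ->|_ [n _ <-]]; first by exists 0%R.
by case: n => n /=; rewrite expg1n ?invg1.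
Qed.

Lemma finite_virtually_cyclic (K : set G) :
  is_subgroup K -> finite_set K -> virtually_cyclic K.
Proof.
move=> sK fK; split => //; exists [set 1%g]; split.
- by move=> _ ->; case: sK.
- exact: cyclic_trivial.
- exact: finite_image.
Qed.

Lemma semidirect_virtually_cyclic (P Z K : set G) : is_subgroup K ->
  finite_set P -> cyclic_subgroup Z -> semidirect P Z K -> virtually_cyclic K.
Proof.
move=> sK fP cZ [_ [[_ ZM ZV] sZ] _ KE]; split => //; exists Z; split => //.
rewrite /finite_index.
apply: (sub_finite_set _ (finite_image (fun p => [set p * h | h in Z]%g) fP)).
move=> _ [x + <-]; rewrite KE => -[p Pp [z Zz <-]]; exists p => //.
apply/seteqP; split=> _ [h Zh <-].
  by exists (z^-1 * h)%g; [apply: ZM => //; apply: ZV | rewrite mulgA mulgK].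
by exists (z * h)%g; [apply: ZM | rewrite mulgA].
Qed.

End VirtuallyCyclic.

(** * The stabilizer of a free tree *)

Theorem theorem4p4 (R : realType) (N : nat) (hN : (2 <= N)%N)
    (T : gspace R (free_group N)) (hT : cvbar T) (hfree : act_free T) :
  ([/\ is_subgroup (stretch_kernel T) /\ finite_set (stretch_kernel T),
       virtually_cyclic (stabCV T),
       finite_set (stabCV T) -> stabCV T = stretch_kernel T
     & infinite_set (stabCV T) ->
         exists Z : set (outg (free_group N)),
           infinite_cyclic_subgroup Z
           /\ semidirect (stretch_kernel T) Z (stabCV T)])
  /\ (~ dense_branch_orbits T -> finite_set (stabCV T)).
Proof.
have nP := stretch_kernel_normal hN hT hfree; have [sP PK _] := nP.
have fP := stretch_kernel_finite hN hT hfree.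
have sK := stabCV_subgroup hT.
have [KP|nKP] := pselect (stabCV T `<=` stretch_kernel T).
  have KE : stabCV T = stretch_kernel T by apply/seteqP.
  have fK : finite_set (stabCV T) by rewrite KE.
  split=> //; split=> //; exact: finite_virtually_cyclic.
have [phi [c [hc c1 gen]]] := stretch_generator hN hT hfree nKP.
have c0 : (0 < c)%R by exact: lt_trans c1.
have pow_eq1 (n : int) : stretches T (expgz phi n) 1%R -> n = 0%R.
  move=> h1; have e := stretches_unique hN hT hfree (stretches_expgz n hc) h1.
  apply: (ieexprIz c0 (negbT (gt_eqF c1))); by rewrite e expr0z.
have pow_inj : injective (expgz phi).
  move=> m n mn; apply/eqP; rewrite -subr_eq0; apply/eqP/pow_eq1.
  by rewrite expgzD expgzN mn mulgV; exact: stretches1.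
pose Z := range (expgz phi).
have sub_Z : Z `<=` stabCV T.
  by move=> _ [n _ <-]; apply/stabCV_stretches => //; exists (c ^ n)%R;
    exact: stretches_expgz.
have infZ : infinite_set Z.
  move=> /(sub_finite_set (A := range (expgz phi \o Posz))).
  have h : range (expgz phi \o Posz) `<=` Z by move=> _ [n _ <-]; exists (Posz n).
  move=> /(_ h) fin; apply: infinite_nat.
  rewrite -(preimage_range (expgz phi \o Posz)).
  by apply: finite_preimage fin => m n _ _ mn; have [] := pow_inj _ _ mn.
have sdK : semidirect (stretch_kernel T) Z (stabCV T).
  split => //.
  - by split => //; exact: expgz_subgroup.
  - apply/seteqP; split=> z; last by move=> ->; split; [case: sP | exists 0%R].
    move=> [Pz [n _ nE]]; have h1 := (stretch_kernelE hN hT hfree z).1 Pz.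
    by rewrite -nE in h1 *; rewrite (pow_eq1 _ h1).
  - apply/seteqP; split=> [psi /gen[n hn]|_ [p Pp [z Zz <-]]]; last first.
      by case: sK => _ KM _; apply: KM; [exact: PK | exact: sub_Z].
    exists (psi * expgz phi n)%g => //; exists (expgz phi (- n)%R).
      by exists (- n)%R.
    by rewrite -mulgA -expgzD subrr mulg1.
have infK : infinite_set (stabCV T) by move=> /(sub_finite_set sub_Z).
split; first split => //.
- by apply: semidirect_virtually_cyclic sdK => //; exists phi.
- by exists Z; split => //; split => //; exists phi.
- move=> ndense; case: ndense.
  have [rT _ _ _] := hT.
  have tT := rtree_tree_metric rT.
  have span : forall x y : T, exists g h, gp y (act g x) (act h x) = 0%R.
    by apply: minimal_spanned => //; case: hT.
  move=> x /(branch_point_forked rT) fx.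
  have [Phi [H [_ rH]]] := hc.
  have [Psi [d [K [rK pK d1]]]] := pure_exists tT hfree span rH c1.
  move=> O [y Oy] oO.
  have /nbhs_ballP[e e0 ye] : nbhs y O by exact: open_nbhs_nbhs.
  have [k hk] := pure_dense tT hfree rK pK d1 fx span y e0.
  exists (act k x); split; last by exists k.
  by apply: ye; rewrite ballEmdist.
Qed.
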